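(* Let $G$ be a second countable locally compact abelian group, let $v$ be a weight on $G\times\widehat{G}$, let $\Lambda$ be a lattice in $G\times\widehat{G}$, and let $f:[0,\infty)\to[0,\infty)$ be a spectral triple compatible function for $v$ with respect to $\Lambda$. Let $c$ be the Heisenberg $2$-cocycle and let $D$ be the (unbounded) selfadjoint operator on $\ell^2(\Lambda)\oplus\ell^2(\Lambda)$ given by $$D=\begin{pmatrix}0& f(v)\\ f(v)&0\end{pmatrix},$$ where $f(v)$ acts by multiplication by the function $\lambda\mapsto f(v(\lambda))$. Then $(\ell^1_{v^n}(\Lambda,c),\ \ell^2(\Lambda)\oplus\ell^2(\Lambda),\ D)$ is an even spectral triple for $C^*(\Lambda,c)$ whenever $n\ge 1$, and $\ell^1_{v^n}(\Lambda,c)\subset QC^*(\Lambda,c)_k$ for $n\geq k+1$. In other words, if $n\ge k+1$ then the spectral triple is quantum $C^k$. Here $n,k\in\mathbb{N}$.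
   Context: Lattice: a discrete cocompact subgroup. $\widehat G$ is the Pontryagin dual of $G$. Weight: a function $v:G\times\widehat{G}\to[0,\infty)$ with $v(0)\neq 0$ such that (i) $v(\xi+\chi)\le v(\xi)v(\chi)$ for all $\xi,\chi$; (ii) there are $C,s>0$ with $v(\xi)\le C(1+d(\xi,0))^s$ for all $\xi$, where $d$ is a translation-invariant metric generating the topology of $G\times\widehat G$; (iii) $v(\xi)=v(-\xi)$ for all $\xi$. Spectral triple compatible: $f:[0,\infty)\to[0,\infty)$ is spectral triple compatible for $v$ with respect to $\Lambda$ if there are constants $C_{\mathrm{dif}},C_{\mathrm{sm}},C_{\mathrm{gr}}\in[0,\infty)$ such that for all $\lambda,\mu\in\Lambda$: $|f(v(\lambda+\mu))-f(v(\lambda))|\le C_{\mathrm{dif}}f(v(\mu))$; $f(v(\lambda+\mu))\le C_{\mathrm{sm}}f(v(\lambda))f(v(\mu))$; $f(v(\lambda))\le C_{\mathrm{gr}}v(\lambda)$. Heisenberg $2$-cocycle: $c((x_1,\omega_1),(x_2,\omega_2))=\overline{\omega_2(x_1)}$. For a weight $w$, $\ell^1_w(\Lambda,c)$ is $\{a\in\ell^1(\Lambda): \sum_{\lambda}|a(\lambda)|w(\lambda)<\infty\}$ with twisted convolution $(a_1*_c a_2)(\lambda)=\sum_{\lambda'\in\Lambda}a_1(\lambda')a_2(\lambda-\lambda')c(\lambda',\lambda-\lambda')$ and involution $a^*(\lambda)=c(\lambda,\lambda)\overline{a(-\lambda)}$; $\ell^1(\Lambda,c)$ is the case $w=1$.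 $C^*(\Lambda,c)$ is the twisted group $C^*$-algebra, i.e. the $C^*$-completion of $\ell^1(\Lambda,c)$ (full and reduced completions agree as $\Lambda$ is abelian). $C^*(\Lambda,c)$ acts on $\ell^2(\Lambda)$ by the continuous extension of left twisted convolution, and diagonally on $\ell^2(\Lambda)\oplus\ell^2(\Lambda)$. The domain of $D$ is $\{(b,b')^T: f(v)b,\ f(v)b'\in\ell^2(\Lambda)\}$. Spectral triple for a $C^*$-algebra $A$: a triple $(\mathcal A,\mathcal H,D)$ with $\mathcal A\subset A$ a dense $*$-subalgebra, $\mathcal H$ a Hilbert space on which $A$ is represented, and $D$ a densely defined selfadjoint operator on $\mathcal H$, such that for every $a\in\mathcal A$: $a\,\mathrm{Dom}(D)\subset\mathrm{Dom}(D)$, $[D,a]$ extends to a bounded operator, and $a(1+D^2)^{-1/2}$ is compact. It is even if there is a selfadjoint unitary $\gamma$ on $\mathcal H$ commuting with all $a\in\mathcal A$ and anticommuting with $D$. Quantum $C^k$: $\mathrm{ad}^j(|D|)(T)$ denotes the $j$ times iterated commutator $[|D|,[|D|,\dots,[|D|,T]\dots]]$, and $T$ lies in the domain of $\mathrm{ad}^k(|D|)$ if the iterated commutators up to order $k$ are defined and extend to bounded operators. $QA_k:=\{a\in\mathcal A: a \text{ and } [D,a] \text{ are both in } \mathrm{Dom}(\mathrm{ad}^k(|D|))\}$; for $A=C^*(\Lambda,c)$ this is written $QC^*(\Lambda,c)_k$. The spectral triple is quantum $C^k$ ($QC^k$) if for all $a\in\mathcal A$ both $a$ and $[D,a]$ are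 in the domain of $\mathrm{ad}^k(|D|)$.
   Formalization: Compactness of a(1+D²)^{-1/2}, hence the full even spectral triple claim, is proved assuming f(v(λ))→∞ along Λ (finite sublevel sets); it fails otherwise, e.g. v=1, f=id, Λ infinite. All other axioms and quantum C^k are proved without it. *)

(* Defs.v *)
From HB Require Import structures.
From mathcomp Require Import all_boot all_order all_algebra.
From mathcomp Require Import all_classical all_reals all_analysis.
From mathcomp Require Import complex ring_quotient lra.

Set Implicit Arguments.
Unset Strict Implicit.
Unset Printing Implicit Defensive.

Import Order.TTheory GRing.Theory Num.Theory.
Import numFieldNormedType.Exports.
Import ComplexField.

Local Open Scope classical_set_scope.
Local Open Scope complex_scope.
Local Open Scope ring_scope.

(** * Pontryagin dual, written additively, with the compact-open topology *)

Section PontryaginDual.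
Variables (R : realType) (G : topologicalZmodType).

Definition is_character (chi : G -> R[i]^o) : Prop :=
  [/\ continuous chi,
      forall x y, chi (x + y) = chi x * chi y
    & forall x, `|chi x| = 1].

Record dual := Dual {
  dual_fun :> G -> R[i]^o;
  dual_subproof : `[< is_character dual_fun >] }.

HB.instance Definition _ := [isSub for dual_fun].
HB.instance Definition _ := [Choice of dual by <:].

Lemma dualP (chi : dual) : is_character chi.
Proof. exact/asboolP/dual_subproof. Qed.

Lemma dual_ext (chi psi : dual) : (forall x, chi x = psi x) -> chi = psi.
Proof. by move=> h; apply: val_inj; apply/funext. Qed.

Lemma dual_one_subproof : `[< is_character (fun=> 1) >].
Proof.
apply/asboolP; split => [x|x y|x]; [exact: cvg_cst|by rewrite mulr1|].
by rewrite normr1.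
Qed.

Lemma dual_mul_subproof (chi psi : dual) :
  `[< is_character (fun x => chi x * psi x) >].
Proof.
have [cc cM c1] := dualP chi; have [pc pM p1] := dualP psi.
apply/asboolP; split => [x|x y|x].
- by apply: cvgM; [exact: cc|exact: pc].
- by rewrite cM pM mulrACA.
- by rewrite normrM c1 p1 mulr1.
Qed.

Lemma dual_inv_subproof (chi : dual) : `[< is_character (fun x => chi (- x)) >].
Proof.
have [cc cM c1] := dualP chi; apply/asboolP; split => [x|x y|x].
- by apply: continuous_comp; [exact: opp_continuous|exact: cc].
- by rewrite opprD cM.
- by rewrite c1.
Qed.

Definition dual_zero : dual := Dual dual_one_subproof.
Definition dual_add (chi psi : dual) : dual := Dual (dual_mul_subproof chi psi).
Definition dual_opp (chi : dual) : dual := Dual (dual_inv_subproof chi).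

Lemma dual_addA : associative dual_add.
Proof. by move=> a b c; apply: dual_ext => x /=; rewrite mulrA. Qed.

Lemma dual_addC : commutative dual_add.
Proof. by move=> a b; apply: dual_ext => x /=; rewrite mulrC. Qed.

Lemma dual_add0 : left_id dual_zero dual_add.
Proof. by move=> a; apply: dual_ext => x /=; rewrite mul1r. Qed.

Lemma dual_addN : left_inverse dual_zero dual_opp dual_add.
Proof.
move=> a; apply: dual_ext => x /=; have [_ aM a1] := dualP a.
rewrite -aM addNr; have := aM 0 0; rewrite addr0 => e.
have a0 : a 0 != 0 by rewrite -normr_eq0 a1 oner_eq0.
by apply: (mulfI a0); rewrite -e mulr1.
Qed.

HB.instance Definition _ :=
  GRing.isZmodule.Build dual dual_addA dual_addC dual_add0 dual_addN.

HB.instance Definition _ := Topological.copy dual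
  (initial_topology (dual_fun : dual -> {compact-open, G -> R[i]^o})).

End PontryaginDual.

(** * Lattices, weights, compatible functions *)

Section Subgroup.
Variables (V : zmodType) (S : zmodClosed V).

Record subgroup := Subgroup { subgroup_val :> V; _ : subgroup_val \in S }.

HB.instance Definition _ := [isSub for subgroup_val].
HB.instance Definition _ := [Choice of subgroup by <:].
HB.instance Definition _ := [SubChoice_isSubZmodule of subgroup by <:].

End Subgroup.

Section TimeFrequency.
Variables (R : realType) (G : topologicalZmodType).
Local Notation GG := (G * dual R G)%type.

Definition is_lattice (L : zmodClosed GG) : Prop :=
  (forall x : GG, x \in L -> \forall y \near x, y \in L -> y = x) /\
  compact [set: quotient_topology (Quotient.quot L)].

Definition invariant_metric (d : GG -> GG -> R) : Prop :=
  [/\ forall x y, d x y = 0 <-> x = y,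
      forall x y, d x y = d y x,
      forall x y z, d x z <= d x y + d y z
    & forall x y z, d (x + z) (y + z) = d x y].

Definition generates_topology (d : GG -> GG -> R) : Prop :=
  forall (x : GG) (U : set GG),
    nbhs x U <-> exists2 e : R, 0 < e & [set y | d x y < e] `<=` U.

Definition is_weight (v : GG -> R) : Prop :=
  [/\ (forall x, 0 <= v x) /\ v 0 != 0,
      forall x y, v (x + y) <= v x * v y,
      exists d : GG -> GG -> R, [/\ invariant_metric d, generates_topology d
        & exists C s : R, [/\ 0 < C, 0 < s
            & forall x, v x <= C * (1 + d x 0) `^ s]]
    & forall x, v (- x) = v x].

(* [f] is only meaningful on [0, +oo[, where it has to be nonnegative. *)
Definition spectral_triple_compatible (L : zmodClosed GG) (v : GG -> R)
    (f : R -> R) : Prop :=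
  (forall t, 0 <= t -> 0 <= f t) /\
  exists Cdif Csm Cgr : R, [/\ 0 <= Cdif, 0 <= Csm, 0 <= Cgr
    & forall x y : GG, x \in L -> y \in L ->
      [/\ `|f (v (x + y)) - f (v x)| <= Cdif * f (v y),
          f (v (x + y)) <= Csm * f (v x) * f (v y)
        & f (v x) <= Cgr * v x]].

(* [h] tends to infinity along [L].  For [h = f \o v] this does not follow from
   [is_weight] and [spectral_triple_compatible]: the weight [v = 1] with
   [f = id], or any [v] with [f = 0], satisfies both and gives a bounded [D],
   whose resolvent is not compact when [L] is infinite. *)
Definition proper_on (L : zmodClosed GG) (h : GG -> R) : Prop :=
  forall M : R, finite_set [set x : GG | x \in L /\ h x <= M].

Definition heisenberg (L : zmodClosed GG) (x y : subgroup L) : R[i] :=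
  ((subgroup_val y).2 (subgroup_val x).1)^*.

End TimeFrequency.

(** * Operators on Hilbert spaces

   A Hilbert space is an [lmodType] together with a form [ip], linear in the
   first argument.  The predicates below make sense for every form;
   [is_hilbert] is what singles out the Hilbert spaces. *)

Section Operators.
Variables (R : realType) (V : lmodType R[i]) (ip : V -> V -> R[i]).

Definition hnorm (x : V) : R := Num.sqrt (complex.Re (ip x x)).

Definition hcvg (u : nat -> V) (l : V) : Prop :=
  (fun n => hnorm (u n - l)) @ \oo --> (0 : R).

Definition is_hilbert : Prop :=
  [/\ forall a x y z, ip (a *: x + y) z = a * ip x z + ip y z,
      forall x y, ip y x = (ip x y)^*,
      forall x, x != 0 -> 0 < ip x x
    & forall u : nat -> V,
        (forall e : R, 0 < e -> exists N, forall m n,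
          (N <= m)%N -> (N <= n)%N -> hnorm (u m - u n) < e) ->
        exists l, hcvg u l].

Definition bounded_op (T : V -> V) : Prop :=
  (forall a x y, T (a *: x + y) = a *: T x + T y) /\
  exists M : R, forall x, hnorm (T x) <= M * hnorm x.

Definition adjoint_pair (T T' : V -> V) : Prop :=
  forall x y, ip (T x) y = ip x (T' y).

Definition compact_op (T : V -> V) : Prop :=
  bounded_op T /\
  forall u : nat -> V, (exists M : R, forall n, hnorm (u n) <= M) ->
    exists (phi : nat -> nat) (l : V),
      {homo phi : m n / (m < n)%N} /\ hcvg (fun n => T (u (phi n))) l.

Definition op_closure (B : set (V -> V)) : set (V -> V) :=
  [set T | bounded_op T /\ forall e : R, 0 < e ->
     exists2 S, B S & forall x, hnorm (T x - S x) <= e * hnorm x].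

Definition star_subalgebra (B : set (V -> V)) : Prop :=
  [/\ B `<=` bounded_op,
      B (fun=> 0),
      forall a S T, B S -> B T -> B (fun x => a *: S x + T x),
      forall S T, B S -> B T -> B (S \o T)
    & forall T, B T -> exists2 T', B T' & adjoint_pair T T'].

Definition cstar_algebra (A : set (V -> V)) : Prop :=
  star_subalgebra A /\ op_closure A `<=` A.

(* [uapp] is only meaningful on [udom]. *)
Record unbounded := Unbounded { udom : set V; uapp :> V -> V }.

(* The last clause says that the graphs of [D] and of its adjoint coincide. *)
Definition selfadjoint (D : unbounded) : Prop :=
  [/\ udom D 0 /\ forall a x y, udom D x -> udom D y ->
        udom D (a *: x + y) /\ D (a *: x + y) = a *: D x + D y,
      forall x (e : R), 0 < e -> exists2 y, udom D y & hnorm (x - y) < e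
    & forall y z, (udom D y /\ D y = z) <->
        (forall x, udom D x -> ip (D x) y = ip x z)].

Definition usquare (D : unbounded) : unbounded :=
  Unbounded [set x | udom D x /\ udom D (D x)] (fun x => D (D x)).

(* [P] is the absolute value of the selfadjoint operator [D]: the positive
   selfadjoint square root of [D ^ 2], domains included. *)
Definition is_abs (D P : unbounded) : Prop :=
  [/\ selfadjoint P,
      forall x, udom P x -> 0 <= ip (P x) x
    & (forall x, udom (usquare P) x <-> udom (usquare D) x) /\
      forall x, udom (usquare D) x -> usquare P x = usquare D x].

(* [S] is (1 + D ^ 2) ^ (-1/2): the positive square root of the bounded
   inverse of 1 + D ^ 2. *)
Definition is_inv_sqrt (D : unbounded) (S : V -> V) : Prop :=
  [/\ bounded_op S,
      forall x, 0 <= ip (S x) x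
    & forall x, udom (usquare D) (S (S x)) /\
                S (S x) + usquare D (S (S x)) = x].

(* [T] preserves the domain of [D], and [D T - T D], defined on that domain,
   extends to the bounded operator [T']. *)
Definition commutator (D : unbounded) (T T' : V -> V) : Prop :=
  [/\ bounded_op T, bounded_op T',
      forall x, udom D x -> udom D (T x)
    & forall x, udom D x -> T' x = D (T x) - T (D x)].

(* Domain of the k-th power of the derivation ad(P). *)
Fixpoint ad_dom (P : unbounded) (k : nat) (T : V -> V) : Prop :=
  if k is k'.+1 then exists2 T', commutator P T T' & ad_dom P k' T'
  else bounded_op T.

End Operators.

(** * Spectral triples

   [A] is a C*-algebra of bounded operators on the Hilbert space [K], [H] is a
   Hilbert space on which [A] is represented through [pi]. *)

Section SpectralTriple.
Variables (R : realType) (K H : lmodType R[i]).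
Variables (ipK : K -> K -> R[i]) (ipH : H -> H -> R[i]).
Variables (A : set (K -> K)) (pi : (K -> K) -> H -> H).
Variables (calA : set (K -> K)) (D : unbounded H).

Definition representation : Prop :=
  [/\ forall T, A T -> bounded_op ipH (pi T),
      forall a S T, A S -> A T -> forall x,
        pi (fun y => a *: S y + T y) x = a *: pi S x + pi T x,
      forall S T, A S -> A T -> forall x, pi (S \o T) x = pi S (pi T x)
    & forall T T', A T -> A T' -> adjoint_pair ipK T T' ->
        adjoint_pair ipH (pi T) (pi T')].

Definition dense_star_subalgebra : Prop :=
  [/\ star_subalgebra ipK calA, calA `<=` A & A `<=` op_closure ipK calA].

(* All the requirements on a spectral triple except compactness of the
   resolvent. *)
Definition spectral_datum : Prop :=
  [/\ is_hilbert ipK /\ cstar_algebra ipK A,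
      dense_star_subalgebra,
      is_hilbert ipH /\ representation,
      selfadjoint ipH D
    & forall a, calA a -> exists T', commutator ipH D (pi a) T'].

Definition compact_resolvent : Prop :=
  exists2 S, is_inv_sqrt ipH D S &
    forall a, calA a -> compact_op ipH (pi a \o S).

Definition spectral_triple : Prop := spectral_datum /\ compact_resolvent.

Definition has_grading : Prop :=
  exists gamma : H -> H,
    [/\ bounded_op ipH gamma,
        adjoint_pair ipH gamma gamma /\ (forall x, gamma (gamma x) = x),
        forall a, calA a -> forall x, gamma (pi a x) = pi a (gamma x)
      & forall x, udom D x ->
          udom D (gamma x) /\ D (gamma x) = - gamma (D x)].

Definition even_spectral_triple : Prop := spectral_triple /\ has_grading.

Definition quantum_differentiable (k : nat) : set (K -> K) :=
  [set a | calA a /\ exists P, [/\ is_abs ipH D P, ad_dom ipH P k (pi a)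
     & exists2 T', commutator ipH D (pi a) T' & ad_dom ipH P k T']].

Definition quantum_Ck (k : nat) : Prop :=
  exists2 P, is_abs ipH D P & forall a, calA a ->
    ad_dom ipH P k (pi a) /\
    exists2 T', commutator ipH D (pi a) T' & ad_dom ipH P k T'.

End SpectralTriple.

(** * Sequence spaces and twisted convolution on a discrete abelian group *)

Section SequenceSpaces.
Variables (R : realType) (L : zmodType).

(* Unordered sums; meaningful for absolutely summable families. *)
Definition rsum (u : L -> R) : R :=
  fine (\esum_(x in [set: L]) (Num.max (u x) 0)%:E) -
  fine (\esum_(x in [set: L]) (Num.max (- u x) 0)%:E).

Definition csum (u : L -> R[i]) : R[i] :=
  rsum (fun x => complex.Re (u x)) +i* rsum (fun x => complex.Im (u x)).

Definition in_l1 : set (L -> R[i]) :=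
  [set a | (\esum_(x in [set: L]) (Normc.normc (a x))%:E < +oo)%E].

Definition in_l1w (w : L -> R) : set (L -> R[i]) :=
  [set a | in_l1 a /\
    (\esum_(x in [set: L]) (Normc.normc (a x) * w x)%:E < +oo)%E].

Definition in_l2 : set (L -> R[i]) :=
  [set a | (\esum_(x in [set: L]) (Normc.normc (a x) ^+ 2)%:E < +oo)%E].

Definition l2_pred : {pred (L -> R[i])} := fun a => `[< in_l2 a >].

Lemma esum_scale_lty (r : R) (u : L -> R) : 0 <= r -> (forall x, 0 <= u x) ->
  (\esum_(x in [set: L]) (u x)%:E < +oo)%E ->
  (\esum_(x in [set: L]) (r * u x)%:E < +oo)%E.
Proof.
move=> r0 u0 us.
have ufin : (\esum_(x in [set: L]) (u x)%:E)%E \is a fin_num.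
  by rewrite ge0_fin_numE// esum_ge0// => x _; rewrite lee_fin.
apply: (@le_lt_trans _ _ (r%:E * \esum_(x in [set: L]) (u x)%:E)%E); last first.
  by rewrite -(fineK ufin) -EFinM ltry.
apply: ge_ereal_sup => _ [X [finX XI] <-].
under eq_fsbigr do rewrite EFinM.
rewrite -ge0_mule_fsumr => [|x]; last by rewrite lee_fin.
apply: lee_pmul => //; first by apply: fsume_ge0 => x _; rewrite lee_fin.
  by apply: ereal_sup_ubound; exists X.
Qed.

Lemma normc_ge0 (z : R[i]) : 0 <= Normc.normc z.
Proof. by case: z => a b; exact: sqrtr_ge0. Qed.

Lemma l2_submod_closed : submod_closed l2_pred.
Proof.
split=> [|s a b /asboolP ha /asboolP hb]; apply/asboolP; rewrite /in_l2 /=.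
  rewrite esum1 ?ltry// => x _; congr EFin.
  exact: (etrans (congr1 (fun t => t ^+ 2) (Normc.normc0 R)) (expr0n _ _)).
have K x : 0 <= 2 * Normc.normc s ^+ 2 * Normc.normc (a x) ^+ 2.
  by rewrite !mulr_ge0// ?normc_ge0.
have K' x : 0 <= 2 * Normc.normc (b x) ^+ 2.
  by rewrite mulr_ge0// sqr_ge0.
have sum : (\esum_(x in [set: L])
    ((2 * Normc.normc s ^+ 2 * Normc.normc (a x) ^+ 2)%:E +
     (2 * Normc.normc (b x) ^+ 2)%:E) < +oo)%E.
  rewrite esumD => [|x _|x _]; rewrite ?lee_fin//.
  have s0 : 0 <= 2 * Normc.normc s ^+ 2 by rewrite mulr_ge0// sqr_ge0.
  by apply: lte_add_pinfty; apply: esum_scale_lty => // x; rewrite sqr_ge0.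
apply: le_lt_trans sum; apply: le_esum => x _; rewrite -EFinD lee_fin.
have /= := le_normcD (s *: a x) (b x); rewrite [Normc.normc (s *: a x)]Normc.normcM.
move: (normc_ge0 (s *: a x + b x)) => n0 h.
have : (Normc.normc (s *: a x + b x)) ^+ 2 <=
       (Normc.normc s * Normc.normc (a x) + Normc.normc (b x)) ^+ 2.
  by rewrite lerXn2r// nnegrE (le_trans n0 h).
rewrite -mulrA -exprMn => /le_trans; apply.
have := sqr_ge0 (Normc.normc s * Normc.normc (a x) - Normc.normc (b x)).
by rewrite sqrrB sqrrD; lra.
Qed.

HB.instance Definition _ :=
  GRing.isSubmodClosed.Build R[i] (L -> R[i]) l2_pred l2_submod_closed.

Record l2 := L2 { l2_fun :> L -> R[i]; _ : l2_fun \in l2_pred }.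

HB.instance Definition _ := [isSub for l2_fun].
HB.instance Definition _ := [Choice of l2 by <:].
HB.instance Definition _ := [SubChoice_isSubLmodule of l2 by <:].

Definition l2_ip (a b : l2) : R[i] := csum (fun x => a x * (b x)^*).

(* [to_l2 a] is [a] when [a] is square summable, and 0 otherwise. *)
Definition to_l2 (a : L -> R[i]) : l2 := insubd (0 : l2) a.

Section Twisted.
Variable c : L -> L -> R[i].

Definition tconv (a b : L -> R[i]) (x : L) : R[i] :=
  csum (fun y => a y * b (x - y) * c y (x - y)).

Definition tstar (a : L -> R[i]) (x : L) : R[i] := c x x * (a (- x))^*.

Definition lconv (a : L -> R[i]) (b : l2) : l2 := to_l2 (tconv a b).

(* The weighted space is a *-algebra for the twisted operations, and [lconv]
   identifies it with a *-algebra of operators on l2. *)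
Definition twisted_embedding (w : L -> R) : Prop :=
  [/\ forall s a b, in_l1w w a -> in_l1w w b ->
        in_l1w w (s *: a + b) /\
        lconv (s *: a + b) = (fun x => s *: lconv a x + lconv b x),
      forall a b, in_l1w w a -> in_l1w w b ->
        in_l1w w (tconv a b) /\ lconv (tconv a b) = lconv a \o lconv b,
      forall a, in_l1w w a ->
        in_l1w w (tstar a) /\ adjoint_pair l2_ip (lconv a) (lconv (tstar a)),
      forall a, in_l1w w a -> bounded_op l2_ip (lconv a)
    & forall a b, in_l1w w a -> in_l1w w b -> lconv a = lconv b -> a = b].

(* The completion of l1 in the operator norm of its action on l2, i.e. the
   reduced completion; it equals the full one since the group is abelian. *)
Definition twisted_cstar : set (l2 -> l2) := op_closure l2_ip (lconv @` in_l1).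

Definition twisted_l1w (w : L -> R) : set (l2 -> l2) := lconv @` in_l1w w.

End Twisted.

Definition dsum_ip (p q : (l2 * l2)%type) : R[i] :=
  l2_ip p.1 q.1 + l2_ip p.2 q.2.

Definition diag_action (T : l2 -> l2) (p : (l2 * l2)%type) : (l2 * l2)%type :=
  (T p.1, T p.2).

Definition mul_fun (h : L -> R) (b : L -> R[i]) (x : L) : R[i] :=
  (h x)%:C * b x.

(* The matrix with zero diagonal and both off-diagonal entries equal to
   multiplication by [h]. *)
Definition offdiag (h : L -> R) : unbounded (l2 * l2)%type :=
  Unbounded
    [set p : (l2 * l2)%type | in_l2 (mul_fun h p.1) /\ in_l2 (mul_fun h p.2)]
    (fun p => (to_l2 (mul_fun h p.2), to_l2 (mul_fun h p.1))).

End SequenceSpaces.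

(* Main.v *)
(* Left twisted convolution by [a] has kernel [a y * c y (x - y)], and commuting
   an operator with kernel [k x y] with multiplication by [h = f(v)] multiplies
   the kernel by [h x - h (x - y)].  Compatibility of [f] bounds this factor by
   [Cdif * Cgr * v y], so the j-th iterated commutator of [a] has a kernel
   dominated by a multiple of [|a y| * v y ^ n] as soon as [j <= n]; by Young's
   inequality an operator with kernel dominated by a summable function of [y]
   is bounded on l2.  The commutator with [D] itself accounts for one order, and
   for the condition [k + 1 <= n].  When [h] is proper, [(1 + D^2)^(-1/2)] is
   multiplication by a function vanishing at infinity, hence compact. *)
Require Import Defs.
From HB Require Import structures.
From mathcomp Require Import all_boot all_order all_algebra.
From mathcomp Require Import all_classical all_reals all_analysis.
From mathcomp Require Import complex ring_quotient.
From mathcomp Require Import finmap ring lra.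

Import Order.TTheory GRing.Theory Num.Theory.
Import numFieldNormedType.Exports.
Local Open Scope classical_set_scope.
Local Open Scope ring_scope.

Set Implicit Arguments.
Unset Strict Implicit.
Unset Printing Implicit Defensive.

(** * Absolutely summable families *)

Section NonnegSums.
Variables (R : realType) (L : zmodType).
Implicit Types p q : L -> R.

(** A weight is at least 1 everywhere: [v 0 <= v 0 * v 0] with [v 0 != 0] gives [1 <= v 0], and
    [v 0 <= v x * v (- x) = v x ^+ 2]. Hence powers of [v] increase with the exponent, and one
    summable function dominates the kernels of all iterated commutators at once; the induction on
    the order only counts how many factors [h x - h (x - y)] can still be afforded. Indexing kernels
    by the displacement [y] keeps the class stable under commutation, and the identity behind the
    commutator formula also yields invariance of the domain. [D] and its absolute value are the same
    multiplication on two copies of l2, with and without a flip of the summands, so commutators are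
    computed on a single copy. The algebraic side rests on the cocycle being a unimodular
    bicharacter. Sums are read off from extended nonnegative sums and carry information only for
    summable families, so every splitting or exchange of sums is preceded by a domination
    argument. *)

Definition summ p : Prop := (\esum_(x in [set: L]) (p x)%:E < +oo)%E.
(** [fine] sends an infinite sum to 0, so the value is meaningful only together with [summ p]. *)
Definition nsum p : R := fine (\esum_(x in [set: L]) (p x)%:E).

Lemma nsumE p : (forall x, 0 <= p x) -> summ p ->
  (nsum p)%:E = (\esum_(x in [set: L]) (p x)%:E)%E.
Proof.
move=> p0 ps; rewrite fineK// ge0_fin_numE// esum_ge0// => x _.
by rewrite lee_fin.
Qed.

Lemma nsum_ge0 p : (forall x, 0 <= p x) -> 0 <= nsum p.
Proof. by move=> p0; apply: fine_ge0; apply: esum_ge0 => x _; rewrite lee_fin. Qed.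

Lemma eq_nsum p q : p =1 q -> nsum p = nsum q.
Proof. by move=> /funext ->. Qed.

Lemma le_summ p q : (forall x, p x <= q x) -> summ q -> summ p.
Proof. by move=> pq; apply: le_lt_trans; apply: le_esum => x _; rewrite lee_fin. Qed.

Lemma le_nsum p q : (forall x, 0 <= p x) -> (forall x, p x <= q x) -> summ q ->
  nsum p <= nsum q.
Proof.
move=> p0 pq qs; have ps := le_summ pq qs.
have q0 x : 0 <= q x := le_trans (p0 x) (pq x).
by rewrite -lee_fin !nsumE//; apply: le_esum => x _; rewrite lee_fin.
Qed.

(** The criterion for limit arguments: pointwise limits pass through finite sums, and the bound then
    reaches the full sum. *)
Lemma nsum_le p (M : R) :
  (forall X : {fset L}, \sum_(x <- X) p x <= M) -> (forall x, 0 <= p x) ->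
  summ p /\ nsum p <= M.
Proof.
move=> h p0; have hE : (\esum_(x in [set: L]) (p x)%:E <= M%:E)%E.
  apply: ge_ereal_sup => _ [X [finX _] <-].
  by rewrite fsbig_finite//= sumEFin lee_fin.
have ps : summ p by apply: le_lt_trans hE _; rewrite ltry.
by split=> //; rewrite -lee_fin nsumE.
Qed.

Lemma sum_le_nsum p (X : {fset L}) : (forall x, 0 <= p x) -> summ p ->
  \sum_(x <- X) p x <= nsum p.
Proof.
move=> p0 ps; rewrite -lee_fin nsumE// -sumEFin.
apply: esum_ge; exists [set` X]; first by split; [exact: finite_fset|].
by rewrite fsbig_finite//= set_fsetK.
Qed.

Lemma le_nsum1 p x : (forall x, 0 <= p x) -> summ p -> p x <= nsum p.
Proof.
by move=> p0 ps; have := sum_le_nsum [fset x]%fset p0 ps; rewrite big_seq_fset1.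
Qed.

Lemma nsum_approx p e : (forall x, 0 <= p x) -> summ p -> 0 < e ->
  exists X : {fset L}, nsum p - e < \sum_(x <- X) p x.
Proof.
move=> p0 ps e0.
have : ((nsum p - e)%:E < \esum_(x in [set: L]) (p x)%:E)%E.
  by rewrite -nsumE// lte_fin; lra.
move=> /ereal_sup_gt[_ [X [finX _] <-]]; rewrite fsbig_finite//= sumEFin lte_fin.
by exists (fset_set X).
Qed.

Lemma summD p q : (forall x, 0 <= p x) -> (forall x, 0 <= q x) ->
  summ p -> summ q -> summ (fun x => p x + q x).
Proof.
move=> p0 q0 ps qs; rewrite /summ; under eq_esum do rewrite EFinD.
rewrite esumD => [|x _|x _]; rewrite ?lee_fin//.
exact: lte_add_pinfty.
Qed.

Lemma nsumD p q : (forall x, 0 <= p x) -> (forall x, 0 <= q x) ->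
  summ p -> summ q -> nsum (fun x => p x + q x) = nsum p + nsum q.
Proof.
move=> p0 q0 ps qs; apply: EFin_inj; rewrite nsumE; last first.
- exact: summD.
- by move=> x; rewrite addr_ge0.
rewrite EFinD !nsumE// -esumD => [|x _|x _]; rewrite ?lee_fin//.
Qed.

Lemma summZ p r : (forall x, 0 <= p x) -> 0 <= r -> summ p ->
  summ (fun x => r * p x).
Proof. by move=> p0 r0; apply: esum_scale_lty. Qed.

Lemma ge0_esumZl p r : (forall x, 0 <= p x) -> 0 <= r ->
  (\esum_(x in [set: L]) (r * p x)%:E = r%:E * \esum_(x in [set: L]) (p x)%:E)%E.
Proof.
move=> p0 r0; rewrite /esum -ereal_supZl//; last first.
  by apply/set0P; eexists; exists set0 => //; split.
congr ereal_sup; apply/seteqP; split=> [_ [X fX <-]|_ [_ [X fX <-] <-]] /=.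
  exists (\sum_(x \in X) (p x)%:E)%E; first by exists X.
  by rewrite ge0_mule_fsumr// => x; rewrite lee_fin.
by exists X => //; rewrite ge0_mule_fsumr// => x; rewrite lee_fin.
Qed.

Lemma nsumZ p r : (forall x, 0 <= p x) -> 0 <= r -> summ p ->
  nsum (fun x => r * p x) = r * nsum p.
Proof.
move=> p0 r0 ps; apply: EFin_inj; rewrite nsumE; last exact: summZ.
  by rewrite ge0_esumZl// EFinM nsumE.
by move=> x; rewrite mulr_ge0.
Qed.

Lemma summ0 : summ (fun=> 0).
Proof. by rewrite /summ esum1 ?ltry. Qed.

Lemma nsum0 : nsum (fun=> 0) = 0.
Proof. by rewrite /nsum esum1. Qed.

Lemma summ_fin_supp p (X : {fset L}) : (forall x, x \notin X -> p x = 0) ->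
  (forall x, 0 <= p x) -> summ p /\ nsum p = \sum_(x <- X) p x.
Proof.
move=> pX p0.
have [ps le1] : summ p /\ nsum p <= \sum_(x <- X) p x.
  apply: nsum_le => // Y.
  (* Both sums are split at the other index set. The common part is the sum over the intersection,
     and the remainder on the right is nonnegative. *)
  rewrite (bigID (mem X))/= [X in _ + X]big1 ?addr0; last by move=> x /pX.
  rewrite -big_filter [leRHS](bigID (mem Y))/= -[X in _ <= X + _]big_filter.
  rewrite (perm_big [seq i <- X | i \in Y]); last first.
    apply: uniq_perm; rewrite ?filter_uniq ?fset_uniq// => x.
    by rewrite !mem_filter andbC.
  by rewrite lerDl sumr_ge0.
by split=> //; apply/eqP; rewrite eq_le le1 sum_le_nsum.
Qed.

Lemma esum_bij (e e' : L -> L) (u : L -> \bar R) : cancel e e' -> cancel e' e ->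
  (\esum_(x in [set: L]) u x = \esum_(x in [set: L]) u (e x))%E.
Proof.
move=> eK e'K; apply: reindex_esum; split=> //.
- by move=> x y _ _ /(congr1 e'); rewrite !eK.
- by move=> y _; exists (e' y).
Qed.

Lemma summ_bij (e e' : L -> L) p : cancel e e' -> cancel e' e ->
  summ p -> summ (fun x => p (e x)).
Proof. by move=> eK e'K; rewrite /summ (esum_bij _ eK e'K). Qed.

Lemma nsum_bij (e e' : L -> L) p : cancel e e' -> cancel e' e ->
  nsum (fun x => p (e x)) = nsum p.
Proof. by move=> eK e'K; rewrite /nsum -(esum_bij (EFin \o p) eK e'K). Qed.

Lemma esum_exchange (p : L -> L -> R) : (forall x y, 0 <= p x y) ->
  (\esum_(x in [set: L]) \esum_(y in [set: L]) (p x y)%:E =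
   \esum_(y in [set: L]) \esum_(x in [set: L]) (p x y)%:E)%E.
Proof.
move=> p0; rewrite !esum_esum => [|x y _ _|x y _ _]; rewrite ?lee_fin//.
rewrite (reindex_esum ([set: L] `*`` (fun=> [set: L])) _ (fun x => (x.2, x.1)))//.
split=> //= [[a b] [c d] _ _ [-> ->]//|[a b] _]; by exists (b, a).
Qed.

(** Joint summability as an iterated extended sum: Tonelli makes it symmetric in the two variables,
    and it is the hypothesis of every exchange of finite-valued sums below. *)
Definition summ2 (p : L -> L -> R) : Prop :=
  (\esum_(x in [set: L]) \esum_(y in [set: L]) (p x y)%:E < +oo)%E.

Lemma summ2P (p : L -> L -> R) : (forall x y, 0 <= p x y) ->
  summ2 p <-> (forall x, summ (p x)) /\ summ (fun x => nsum (p x)).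
Proof.
move=> p0; have e0 x : (0 <= \esum_(y in [set: L]) (p x y)%:E)%E.
  by apply: esum_ge0 => y _; rewrite lee_fin.
split=> [ps|[ps nps]]; last first.
  rewrite /summ2; under eq_esum do rewrite -nsumE//.
  exact: nps.
have ps1 x : summ (p x).
  apply: le_lt_trans ps; rewrite [leRHS](esumID [set x])//.
  by rewrite setTI esum_set1// leeDl// esum_ge0.
split=> //; rewrite /summ; under eq_esum do rewrite nsumE//.
exact: ps.
Qed.

Lemma summ2_swap (p : L -> L -> R) : (forall x y, 0 <= p x y) ->
  summ2 p -> summ2 (fun y x => p x y).
Proof. by move=> p0; rewrite /summ2 esum_exchange. Qed.

Lemma le_summ2 (p q : L -> L -> R) : (forall x y, p x y <= q x y) ->
  summ2 q -> summ2 p.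
Proof.
move=> pq; apply: le_lt_trans; apply: le_esum => x _; apply: le_esum => y _.
by rewrite lee_fin.
Qed.

Lemma nsum_exchange (p : L -> L -> R) : (forall x y, 0 <= p x y) -> summ2 p ->
  nsum (fun x => nsum (p x)) = nsum (fun y => nsum (fun x => p x y)).
Proof.
move=> p0 ps; have [p1 p2] := (summ2P p0).1 ps.
have [q1 q2] := (summ2P (fun x y => p0 y x)).1 (summ2_swap p0 ps).
apply: EFin_inj; rewrite !nsumE//; try by move=> x; apply: nsum_ge0.
under eq_esum do rewrite nsumE//.
by rewrite esum_exchange//; apply: eq_esum => y _; rewrite nsumE.
Qed.

End NonnegSums.

Arguments summ {R L}.
Arguments nsum {R L}.
Arguments summ2 {R L}.

(** * Modulus, real and imaginary part of complex numbers *)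

Section Normc.
Variable R : realType.
Implicit Types z w : R[i].
Local Notation normc := Normc.normc.
Local Notation Re := complex.Re.
Local Notation Im := complex.Im.

Lemma normcD z w : normc (z + w) <= normc z + normc w.
Proof. exact: (@le_normcD R z w). Qed.

Lemma normcN z : normc (- z) = normc z.
Proof. exact: (@complex.normcN R z). Qed.

Lemma normcB z w : normc (z - w) = normc (w - z).
Proof. by rewrite -normcN opprB. Qed.

Lemma normc_conj z : normc (z^* ) = normc z.
Proof. by case: z => a b /=; rewrite sqrrN. Qed.

Lemma normc_real (r : R) : normc (real_complex R r) = `|r|.
Proof. by rewrite /= expr0n/= addr0 sqrtr_sqr. Qed.

Lemma Re_le_normc z : `|Re z| <= normc z.
Proof. by case: z => a b /=; rewrite -sqrtr_sqr ler_wsqrtr// lerDl sqr_ge0. Qed.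

Lemma Im_le_normc z : `|Im z| <= normc z.
Proof. by case: z => a b /=; rewrite -sqrtr_sqr ler_wsqrtr// lerDr sqr_ge0. Qed.

Lemma mul_conj_normc z : z * z^* = real_complex R (normc z ^+ 2).
Proof.
case: z => a b; rewrite -[(a +i* b)%C^*%R]/(a -i* b)%C /=.
rewrite sqr_sqrtr ?addr_ge0 ?sqr_ge0//.
rewrite -[LHS]/((a * a - b * - b) +i* (a * - b + b * a))%C.
by congr (_ +i* _)%C; ring.
Qed.

Lemma eq_complexP z w : Re z = Re w -> Im z = Im w -> z = w.
Proof. by case: z w => a b [c d] /= -> ->. Qed.

Lemma ReD z w : Re (z + w) = Re z + Re w.
Proof. by case: z w => a b [c d]. Qed.

Lemma ImD z w : Im (z + w) = Im z + Im w.
Proof. by case: z w => a b [c d]. Qed.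

Lemma ReM z w : Re (z * w) = Re z * Re w - Im z * Im w.
Proof. by case: z w => a b [c d]. Qed.

Lemma ImM z w : Im (z * w) = Re z * Im w + Im z * Re w.
Proof. by case: z w => a b [c d]. Qed.

Lemma ReJ z : Re (z^* ) = Re z. Proof. by case: z. Qed.

Lemma ImJ z : Im (z^* ) = - Im z. Proof. by case: z. Qed.

Lemma ReN z : Re (- z) = - Re z. Proof. by case: z. Qed.

Lemma ImN z : Im (- z) = - Im z. Proof. by case: z. Qed.

End Normc.

(** * Absolutely convergent real and complex sums *)

Section ComplexSums.
Variables (R : realType) (L : zmodType).
Implicit Types (p q u v : L -> R) (a b : L -> R[i]).
Local Notation normc := Normc.normc.
Local Notation Re := complex.Re.
Local Notation Im := complex.Im.

(** Positive and negative parts are not additive, so linearity of [rsum] cannot be read off its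
    definition. It follows once any difference of summable nonnegative families, and not only the
    canonical one, may be used to compute the sum. *)
Lemma rsum_sub p q : (forall x, 0 <= p x) -> (forall x, 0 <= q x) ->
  summ p -> summ q -> rsum (fun x => p x - q x) = nsum p - nsum q.
Proof.
move=> p0 q0 ps qs.
have m1 x : 0 <= Num.max (p x - q x) 0 by rewrite le_max lexx orbT.
have m2 x : 0 <= Num.max (- (p x - q x)) 0 by rewrite le_max lexx orbT.
have s1 : summ (fun x => Num.max (p x - q x) 0).
  by apply: le_summ ps => x; rewrite ge_max p0 andbT gerBl q0.
have s2 : summ (fun x => Num.max (- (p x - q x)) 0).
  by apply: le_summ qs => x; rewrite ge_max q0 andbT opprB gerBl p0.
rewrite /rsum -/(nsum _) -/(nsum _).
(* Moving the subtracted terms across leaves an identity between nonnegative families, where [nsumD]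
   applies. *)
suff : nsum (fun x => Num.max (p x - q x) 0) + nsum q =
       nsum (fun x => Num.max (- (p x - q x)) 0) + nsum p by lra.
rewrite -!nsumD//; apply: eq_nsum => x.
by rewrite opprB !maxElt; case: ifPn; case: ifPn; lra.
Qed.

Lemma pos_le u x : Num.max (u x) 0 <= `|u x|.
Proof. by rewrite ge_max ler_norm normr_ge0. Qed.

Lemma neg_le u x : Num.max (- u x) 0 <= `|u x|.
Proof. by rewrite ge_max -normrN ler_norm normr_ge0. Qed.

Lemma max0_ge0 (r : R) : 0 <= Num.max r 0.
Proof. by rewrite le_max lexx orbT. Qed.

Lemma posneg (r : R) : r = Num.max r 0 - Num.max (- r) 0.
Proof. by rewrite !maxElt; case: ifPn; case: ifPn; lra. Qed.

Hint Resolve max0_ge0 : core.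

Let summ_pos u : summ (fun x => `|u x|) -> summ (fun x => Num.max (u x) 0).
Proof. by apply: le_summ => x; exact: pos_le. Qed.

Let summ_neg u : summ (fun x => `|u x|) -> summ (fun x => Num.max (- u x) 0).
Proof. by apply: le_summ => x; exact: neg_le. Qed.

Lemma rsum_ge0 p : (forall x, 0 <= p x) -> summ p -> rsum p = nsum p.
Proof.
move=> p0 ps; rewrite -[RHS]subr0 -(nsum0 R L) -rsum_sub//; last exact: summ0.
by congr rsum; apply/funext => x; rewrite subr0.
Qed.

Lemma rsumD u v : summ (fun x => `|u x|) -> summ (fun x => `|v x|) ->
  rsum (fun x => u x + v x) = rsum u + rsum v.
Proof.
move=> us vs.
transitivity (rsum (fun x => (Num.max (u x) 0 + Num.max (v x) 0) -
                             (Num.max (- u x) 0 + Num.max (- v x) 0))).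
  congr rsum; apply/funext => x.
  by rewrite {1}(posneg (u x)) {1}(posneg (v x)); lra.
rewrite rsum_sub; first by rewrite !nsumD//; [rewrite /rsum -/(nsum _);
  rewrite /nsum; lra| exact: summ_neg | exact: summ_neg
  | exact: summ_pos | exact: summ_pos].
- by move=> x; rewrite addr_ge0.
- by move=> x; rewrite addr_ge0.
- by apply: summD => //; exact: summ_pos.
- by apply: summD => //; exact: summ_neg.
Qed.

Lemma rsumN u : rsum (fun x => - u x) = - rsum u.
Proof.
by rewrite /rsum opprB; congr (_ - fine _); apply: eq_esum => x _; rewrite opprK.
Qed.

Lemma rsumZ (r : R) u : summ (fun x => `|u x|) ->
  rsum (fun x => r * u x) = r * rsum u.
Proof.
move=> us; wlog r0 : r / 0 <= r => [h|].
  have [/h//|r0] := leP 0 r.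
  have := h (- r); rewrite oppr_ge0 ltW// => /(_ isT).
  under eq_fun do rewrite mulNr.
  by rewrite rsumN mulNr => /oppr_inj.
rewrite /rsum -/(nsum _) -/(nsum _) -/(nsum _) -/(nsum _) mulrBr -!nsumZ//; last 2 first.
- exact: summ_neg.
- exact: summ_pos.
congr (_ - _); apply: eq_nsum => x.
  by rewrite maxr_pMr// mulr0.
by rewrite maxr_pMr// mulr0 mulrN.
Qed.

Lemma rsum_norm_le u : summ (fun x => `|u x|) -> `|rsum u| <= nsum (fun x => `|u x|).
Proof.
move=> us; rewrite /rsum -/(nsum _) -/(nsum _).
have h : nsum (fun x => `|u x|) =
    nsum (fun x => Num.max (u x) 0) + nsum (fun x => Num.max (- u x) 0).
  rewrite -nsumD//; [|exact: summ_pos|exact: summ_neg].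
  apply: eq_nsum => x; rewrite !maxElt.
  by case: (ler0P (u x)) => u0; rewrite ?ltNge; do ?case: ifPn; lra.
have h1 := nsum_ge0 (fun x => max0_ge0 (u x)).
have h2 := nsum_ge0 (fun x => max0_ge0 (- u x)).
by rewrite ler_norml h; lra.
Qed.

Lemma rsum_bij (e e' : L -> L) u : cancel e e' -> cancel e' e ->
  rsum (fun x => u (e x)) = rsum u.
Proof.
move=> eK e'K; rewrite /rsum.
rewrite -(esum_bij (fun x => (Num.max (u x) 0)%:E) eK e'K).
by rewrite -(esum_bij (fun x => (Num.max (- u x) 0)%:E) eK e'K).
Qed.

(** Tonelli applied to the positive and the negative part, each dominated by the absolute value. *)
Lemma rsum_exchange (u : L -> L -> R) : summ2 (fun x y => `|u x y|) ->
  rsum (fun x => rsum (u x)) = rsum (fun y => rsum (fun x => u x y)).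
Proof.
move=> us.
have up : summ2 (fun x y => Num.max (u x y) 0).
  by apply: le_summ2 us => x y; exact: pos_le.
have un : summ2 (fun x y => Num.max (- u x y) 0).
  by apply: le_summ2 us => x y; exact: neg_le.
have p0 (w : L -> L -> R) x y : 0 <= Num.max (w x y) 0 by [].
have [_ up2] := (summ2P (p0 u)).1 up.
have [_ un2] := (summ2P (p0 (fun x y => - u x y))).1 un.
have [_ vp2] := (summ2P (fun x y => p0 u y x)).1 (summ2_swap (p0 u) up).
have [_ vn2] := (summ2P (fun x y => p0 (fun x y => - u x y) y x)).1
  (summ2_swap (p0 (fun x y => - u x y)) un).
rewrite {2 4}/rsum rsum_sub//; try by move=> x; apply: nsum_ge0.
rewrite rsum_sub//; try by move=> x; apply: nsum_ge0.
by rewrite nsum_exchange// [X in _ - X]nsum_exchange.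
Qed.

Definition summc a : Prop := summ (fun x => normc (a x)).

Let summcRe a : summc a -> summ (fun x => `|Re (a x)|).
Proof. by apply: le_summ => x; exact: Re_le_normc. Qed.

Let summcIm a : summc a -> summ (fun x => `|Im (a x)|).
Proof. by apply: le_summ => x; exact: Im_le_normc. Qed.

Lemma eq_csum a b : a =1 b -> csum a = csum b.
Proof. by move=> /funext ->. Qed.

Lemma summcD a b : summc a -> summc b -> summc (fun x => a x + b x).
Proof.
move=> sa sb; apply: le_summ (summD _ _ sa sb) => x; first exact: normcD.
  exact: normc_ge0.
exact: normc_ge0.
Qed.

Lemma summcZ s a : summc a -> summc (fun x => s * a x).
Proof.
move=> sa; rewrite /summc; under eq_fun do rewrite Normc.normcM.
by apply: summZ => // [x|]; exact: normc_ge0.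
Qed.

Lemma csumD a b : summc a -> summc b ->
  csum (fun x => a x + b x) = csum a + csum b.
Proof.
move=> sa sb.
have [ra ia] := (summcRe sa, summcIm sa); have [rb ib] := (summcRe sb, summcIm sb).
apply: eq_complexP; rewrite ?ReD ?ImD /csum/=.
- by rewrite -(rsumD ra rb); congr rsum; apply/funext => x; rewrite ReD.
- by rewrite -(rsumD ia ib); congr rsum; apply/funext => x; rewrite ImD.
Qed.

Lemma csumZ s a : summc a -> csum (fun x => s * a x) = s * csum a.
Proof.
move=> sa; have Zs (r : R) (u : L -> R) : summ (fun x => `|u x|) ->
    summ (fun x => `|r * u x|).
  by move=> us; under eq_fun do rewrite normrM; apply: summZ.
have [ra ia] := (summcRe sa, summcIm sa).
apply: eq_complexP; rewrite ?ReM ?ImM /csum/=.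
- under eq_fun do rewrite ReM -mulNr.
  rewrite -mulNr -(rsumZ _ ra) -(rsumZ _ ia).
  by rewrite -(rsumD (Zs _ _ ra) (Zs _ _ ia)).
- under eq_fun do rewrite ImM.
  rewrite -(rsumZ _ ra) -(rsumZ _ ia).
  by rewrite -(rsumD (Zs _ _ ia) (Zs _ _ ra)).
Qed.

Lemma csumJ a : csum (fun x => (a x)^* ) = (csum a)^*.
Proof.
apply: eq_complexP; rewrite ?ReJ ?ImJ /csum/=.
  by congr rsum; apply/funext => x; rewrite ReJ.
by rewrite -rsumN; congr rsum; apply/funext => x; rewrite ImJ.
Qed.

Lemma csum_bij (e e' : L -> L) a : cancel e e' -> cancel e' e ->
  csum (fun x => a (e x)) = csum a.
Proof.
move=> eK e'K; rewrite /csum (rsum_bij (fun x => Re (a x)) eK e'K).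
by rewrite (rsum_bij (fun x => Im (a x)) eK e'K).
Qed.

Lemma csum_exchange (u : L -> L -> R[i]) :
  summ2 (fun x y => normc (u x y)) ->
  csum (fun x => csum (u x)) = csum (fun y => csum (fun x => u x y)).
Proof.
move=> us; rewrite /csum/=; congr (_ +i* _)%C; apply: rsum_exchange.
  by apply: le_summ2 us => x y; exact: Re_le_normc.
by apply: le_summ2 us => x y; exact: Im_le_normc.
Qed.

Lemma csum_real p : (forall x, 0 <= p x) -> summ p ->
  csum (fun x => real_complex R (p x)) = real_complex R (nsum p).
Proof.
move=> p0 ps; rewrite /csum/= rsum_ge0//; congr (_ +i* _)%C.
by rewrite rsum_ge0//; [exact: nsum0|exact: summ0].
Qed.

(** Multiplying by the unimodular phase [s] that rotates the sum onto the positive axis turns its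
    modulus into the real part of a sum, for which the real inequality is available. *)
Lemma normc_csum_le a : summc a -> normc (csum a) <= nsum (fun x => normc (a x)).
Proof.
move=> sa; set S := csum a.
have a0 x : 0 <= normc (a x) by exact: normc_ge0.
have [->|S0] := eqVneq S 0; first by rewrite Normc.normc0 nsum_ge0.
have nS : normc S != 0 by apply: contra S0 => /eqP/Normc.eq0_normc ->.
pose s := S^* / real_complex R (normc S).
have s1 : normc s = 1.
  rewrite Normc.normcM Normc.normcV normc_conj normc_real ger0_norm ?normc_ge0//.
  by rewrite divff.
have -> : normc S = Re (csum (fun x => s * a x)).
  rewrite csumZ// -/S /s mulrAC [_ * S]mulrC mul_conj_normc.
  by rewrite -fmorphV -rmorphM/= expr2 mulfK.
have sa' : summ (fun x => `|Re (s * a x)|) by exact/summcRe/summcZ.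
rewrite /csum/=; apply: le_trans (ler_norm _) _.
apply: le_trans (rsum_norm_le sa') _.
apply: le_nsum => // x; apply: le_trans (Re_le_normc _) _.
by rewrite Normc.normcM s1 mul1r.
Qed.

Lemma csum_supp1 a x : (forall y, y != x -> a y = 0) -> csum a = a x.
Proof.
have rs (u : L -> R) : (forall y, y != x -> u y = 0) -> rsum u = u x.
  move=> ux; have ns (w : L -> R) : (forall y, 0 <= w y) ->
      (forall y, y != x -> w y = 0) -> nsum w = w x.
    move=> w0 wx; have [||_ ->] := @summ_fin_supp _ _ w [fset x]%fset => //.
      by move=> y; rewrite inE; exact: wx.
    by rewrite big_seq_fset1.
  rewrite /rsum -/(nsum _) -/(nsum _) !ns//; first by rewrite -posneg.
    by move=> y /ux ->; rewrite oppr0 maxxx.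
  by move=> y /ux ->; rewrite maxxx.
move=> ax; apply: eq_complexP; rewrite /csum/= rs// => y /ax -> //.
Qed.

End ComplexSums.

(** * Bounded operators on an abstract Hilbert space *)

Lemma le_eps_mul (R : realFieldType) (a b : R) :
  0 <= b -> (forall e, 0 < e -> a <= e * b) -> a <= 0.
Proof.
move=> b0 h; rewrite leNgt; apply/negP => a0.
have b1 : 0 < b + 1 by lra.
(* This choice gives [a <= a / 2]; the [+ 1] covers [b = 0]. *)
have := h (a / (2 * (b + 1))); rewrite divr_gt0 ?mulr_gt0// => /(_ isT).
have -> : a / (2 * (b + 1)) * b = a / 2 * (b / (b + 1)) by field; lra.
have c1 : b / (b + 1) <= 1 by rewrite ler_pdivrMr//; lra.
have : a / 2 * (b / (b + 1)) <= a / 2 * 1 by rewrite ler_wpM2l//; lra.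
lra.
Qed.

Lemma ex_inv_nat (R : realType) (e : R) : 0 < e -> exists n : nat, n.+1%:R^-1 < e.
Proof.
move=> e0; exists (Num.truncn e^-1); rewrite invf_plt ?posrE//.
by rewrite truncnS_gt// ?num_real.
Qed.

Section Hilbert.
Variables (R : realType) (V : lmodType R[i]) (ip : V -> V -> R[i]).
Hypothesis hilb : is_hilbert ip.
Local Notation hnorm := (hnorm ip).
Local Notation Re := complex.Re.
Local Notation Im := complex.Im.
Local Notation normc := Normc.normc.
Implicit Types (x y z : V) (S T : V -> V).

Let ipl a x y z : ip (a *: x + y) z = a * ip x z + ip y z.
Proof. by case: hilb => h _ _ _; apply: h. Qed.

Lemma ipC x y : ip y x = (ip x y)^*.
Proof. by case: hilb => _ h _ _; apply: h. Qed.

Lemma ipDl x y z : ip (x + y) z = ip x z + ip y z.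
Proof. by rewrite -[x]scale1r ipl mul1r scale1r. Qed.

Lemma ip0l z : ip 0 z = 0.
Proof. by apply: (addrI (ip 0 z)); rewrite -ipDl !addr0. Qed.

Lemma ipZl a x z : ip (a *: x) z = a * ip x z.
Proof. by rewrite -[a *: x]addr0 ipl ip0l addr0. Qed.

Lemma ipNl x z : ip (- x) z = - ip x z.
Proof. by rewrite -scaleN1r ipZl mulN1r. Qed.

Lemma ipBl x y z : ip (x - y) z = ip x z - ip y z.
Proof. by rewrite ipDl ipNl. Qed.

Lemma ipDr x y z : ip x (y + z) = ip x y + ip x z.
Proof. by rewrite (ipC (y + z)) (ipC y) (ipC z) ipDl rmorphD. Qed.

Lemma ipZr a x y : ip x (a *: y) = a^* * ip x y.
Proof. by rewrite (ipC (a *: y)) (ipC y) ipZl rmorphM. Qed.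

Lemma ip0r z : ip z 0 = 0.
Proof. by rewrite (ipC 0) ip0l rmorph0. Qed.

Lemma ipNr x y : ip x (- y) = - ip x y.
Proof. by rewrite (ipC (- y)) (ipC y) ipNl rmorphN. Qed.

Lemma ipBr x y z : ip x (y - z) = ip x y - ip x z.
Proof. by rewrite ipDr ipNr. Qed.

Lemma ReipC x y : Re (ip y x) = Re (ip x y).
Proof. by rewrite ipC ReJ. Qed.

Lemma ip_ge0 x : 0 <= ip x x.
Proof.
have [->|x0] := eqVneq x 0; first by rewrite ip0l.
by case: hilb => _ _ h _; apply/ltW/h.
Qed.

Lemma hnorm_ge0 x : 0 <= hnorm x.
Proof. exact: sqrtr_ge0. Qed.

Lemma sqr_hnorm x : hnorm x ^+ 2 = Re (ip x x).
Proof. by rewrite sqr_sqrtr//; have := ip_ge0 x; rewrite lecE => /andP[]. Qed.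

Lemma hnorm0_eq0 x : hnorm x = 0 -> x = 0.
Proof.
move=> h; apply/eqP; apply/negPn/negP => x0.
have : 0 < ip x x by case: hilb => _ _ + _; apply.
by rewrite ltcE -sqr_hnorm h expr0n ltxx andbF.
Qed.

Lemma hnorm0 : hnorm 0 = 0.
Proof. by rewrite /Defs.hnorm ip0l sqrtr0. Qed.

Lemma hnormZ a x : hnorm (a *: x) = normc a * hnorm x.
Proof.
rewrite /Defs.hnorm ipZl ipZr mulrA mul_conj_normc ReM/= mul0r subr0.
by rewrite sqrtrM ?sqr_ge0// sqrtr_sqr ger0_norm ?normc_ge0.
Qed.

Lemma hnormN x : hnorm (- x) = hnorm x.
Proof. by rewrite /Defs.hnorm ipNl ipNr opprK. Qed.

Lemma hnormBC x y : hnorm (x - y) = hnorm (y - x).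
Proof. by rewrite -hnormN opprB. Qed.

Lemma Re_ip_le x y : Re (ip x y) <= hnorm x * hnorm y.
Proof.
have [x0|x0] := eqVneq (hnorm x) 0.
  by rewrite (hnorm0_eq0 x0) ip0l/= mulr_ge0 ?hnorm_ge0.
have [y0|y0] := eqVneq (hnorm y) 0.
  by rewrite (hnorm0_eq0 y0) ip0r/= mulr_ge0 ?hnorm_ge0.
have a0 : 0 < hnorm x by rewrite lt_neqAle eq_sym x0 hnorm_ge0.
have b0 : 0 < hnorm y by rewrite lt_neqAle eq_sym y0 hnorm_ge0.
set a := hnorm x in a0 *; set b := hnorm y in b0 *.
(* Expanding this square with [a] and [b] the norms of [x] and [y] gives
   [0 <= 2 * (a * b) * (a * b - r)], which is Cauchy-Schwarz after division. *)
have := sqr_ge0 (hnorm (real_complex R b *: x - real_complex R a *: y)).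
rewrite sqr_hnorm ipBl !ipBr !ipZl !ipZr ReD ReN !ReD !ReN !ReM !ImM /= !mul0r.
rewrite (ReipC x y).
have -> : Re (ip x x) = a ^+ 2 by rewrite sqr_hnorm.
have -> : Re (ip y y) = b ^+ 2 by rewrite sqr_hnorm.
set r := Re (ip x y) => h.
have : 0 <= 2 * (a * b) * (a * b - r) by lra.
by rewrite pmulr_rge0 ?mulr_gt0// subr_ge0.
Qed.

Lemma normr_Re_ip_le x y : `|Re (ip x y)| <= hnorm x * hnorm y.
Proof.
rewrite ler_norml Re_ip_le andbT lerNl -ReN -ipNl.
by rewrite (le_trans (Re_ip_le _ _))// hnormN.
Qed.

Lemma hnormD x y : hnorm (x + y) <= hnorm x + hnorm y.
Proof.
rewrite -(@ler_pXn2r _ 2)// ?nnegrE ?addr_ge0 ?hnorm_ge0//.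
rewrite sqrrD !sqr_hnorm ipDl !ipDr !ReD (ReipC x y).
by have := Re_ip_le x y; lra.
Qed.

Lemma hnormB x y : hnorm (x - y) <= hnorm x + hnorm y.
Proof. by rewrite (le_trans (hnormD _ _))// hnormN. Qed.

Lemma hnorm_triangle z x y : hnorm (x - y) <= hnorm (x - z) + hnorm (z - y).
Proof. by rewrite -[x - y](subrKA z) hnormD. Qed.

Lemma hcvgP (u : nat -> V) l :
  hcvg ip u l <-> forall e, 0 < e -> exists N, forall n, (N <= n)%N -> hnorm (u n - l) < e.
Proof.
split=> [/cvgrPdist_lt h e e0|h].
  have [N _ hN] := h e e0; exists N => n Nn.
  by have := hN n Nn; rewrite sub0r normrN ger0_norm ?hnorm_ge0.
apply/cvgrPdist_lt => e e0; have [N hN] := h e e0; exists N => // n Nn.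
by rewrite sub0r normrN ger0_norm ?hnorm_ge0// hN.
Qed.

Lemma bounded_opP T : bounded_op ip T ->
  exists2 M, 0 <= M & forall x, hnorm (T x) <= M * hnorm x.
Proof.
move=> [_ [M hM]]; exists `|M| => // x; apply: le_trans (hM x) _.
by rewrite ler_wpM2r ?hnorm_ge0// ler_norm.
Qed.

Section Linear.
Variables (T : V -> V) (Tb : bounded_op ip T).

Lemma bopD x y : T (x + y) = T x + T y.
Proof. by case: Tb => h _; rewrite -[x]scale1r h !scale1r. Qed.

Lemma bop0 : T 0 = 0.
Proof. by apply: (addrI (T 0)); rewrite -bopD !addr0. Qed.

Lemma bopZ a x : T (a *: x) = a *: T x.
Proof. by case: Tb => h _; rewrite -[a *: x]addr0 h bop0 addr0. Qed.

Lemma bopB x y : T (x - y) = T x - T y.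
Proof. by rewrite bopD -[- y]scaleN1r bopZ scaleN1r. Qed.

End Linear.

Lemma bounded_op_cont T u l : bounded_op ip T -> hcvg ip u l ->
  hcvg ip (fun n => T (u n)) (T l).
Proof.
move=> Tb /hcvgP ul; apply/hcvgP => e e0; have [M M0 hM] := bounded_opP Tb.
have M1 : 0 < M + 1 by lra.
have [|N hN] := ul (e / (M + 1)); first by rewrite divr_gt0.
exists N => n Nn; rewrite -(bopB Tb); apply: le_lt_trans (hM _) _.
apply: (@le_lt_trans _ _ ((M + 1) * hnorm (u n - l))).
  by rewrite ler_wpM2r ?hnorm_ge0//; lra.
by rewrite mulrC -ltr_pdivlMr// hN.
Qed.

Lemma bounded_op_lin a S T : bounded_op ip S -> bounded_op ip T ->
  bounded_op ip (fun x => a *: S x + T x).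
Proof.
move=> Sb Tb; split=> [b x y|].
  rewrite (bopD Sb) (bopD Tb) (bopZ Sb) (bopZ Tb) !scalerDr !scalerA mulrC.
  by rewrite addrACA.
have [M M0 hM] := bounded_opP Sb; have [N N0 hN] := bounded_opP Tb.
exists (normc a * M + N) => x; apply: le_trans (hnormD _ _) _.
by rewrite hnormZ mulrDl lerD// -mulrA ler_wpM2l ?normc_ge0.
Qed.

Lemma bounded_op_comp S T : bounded_op ip S -> bounded_op ip T ->
  bounded_op ip (S \o T).
Proof.
move=> Sb Tb; split=> [b x y|]; first by rewrite /= (bopD Tb) (bopZ Tb) (bopD Sb) (bopZ Sb).
have [M M0 hM] := bounded_opP Sb; have [N N0 hN] := bounded_opP Tb.
exists (M * N) => x /=; apply: le_trans (hM _) _.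
by rewrite -mulrA ler_wpM2l.
Qed.

(** Replacing [x] by [-i x] turns real parts into imaginary parts, so estimates on real parts alone
    determine adjoints. *)
Lemma adjoint_pair_Re S T : (forall a x, S (a *: x) = a *: S x) ->
  (forall x y, Re (ip (S x) y) = Re (ip x (T y))) -> adjoint_pair ip S T.
Proof.
move=> SZ h x y; apply: eq_complexP => //.
have := h (- 'i%C *: x) y; rewrite SZ !ipZl !ReM /= oppr0 !mul0r !sub0r.
by rewrite !mulN1r !opprK.
Qed.

(** Testing at [T y]: the square of its norm is the real part of [ip (S (T y)) y], at most [M] times
    the norms of [T y] and [y]; then one factor is cancelled. *)
Lemma adjoint_norm_le S T M : 0 <= M -> adjoint_pair ip S T ->
  (forall x, hnorm (S x) <= M * hnorm x) -> forall y, hnorm (T y) <= M * hnorm y.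
Proof.
move=> M0 ST hS y; have [->|T0] := eqVneq (hnorm (T y)) 0.
  by rewrite mulr_ge0 ?hnorm_ge0.
have T1 : 0 < hnorm (T y) by rewrite lt_neqAle eq_sym T0 hnorm_ge0.
rewrite -(ler_pM2l T1) -expr2 sqr_hnorm -ST.
apply: le_trans (Re_ip_le _ _) _.
by rewrite mulrA ler_wpM2r ?hnorm_ge0// mulrC hS.
Qed.

Lemma ip_ext x y : (forall z, ip z x = ip z y) -> x = y.
Proof.
move=> h; apply/eqP; rewrite -subr_eq0; apply/eqP/hnorm0_eq0/eqP.
by rewrite -sqrf_eq0 sqr_hnorm ipBr h subrr.
Qed.

Lemma adjoint_bounded S T : bounded_op ip S -> adjoint_pair ip S T ->
  bounded_op ip T.
Proof.
move=> Sb ST; split.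
  move=> a x y; apply: ip_ext => z.
  by rewrite -ST !ipDr !ipZr -!ST.
have [M M0 hM] := bounded_opP Sb.
by exists M => x; exact: (adjoint_norm_le M0 ST hM).
Qed.

Lemma subset_op_closure B : B `<=` bounded_op ip -> B `<=` op_closure ip B.
Proof.
move=> Bb T BT; split=> [|e e0]; first exact: Bb.
by exists T => // x; rewrite subrr hnorm0 mulr_ge0 ?hnorm_ge0// ltW.
Qed.

(** Yields both that closures are closed, with [B] itself a closure, and that the weighted algebra
    is dense as soon as it approximates l1. *)
Lemma op_closure_min B C : B `<=` op_closure ip C ->
  op_closure ip B `<=` op_closure ip C.
Proof.
move=> BC T [Tb hT]; split=> // e e0; have e2 : 0 < e / 2 by lra.
have [S BS hS] := hT _ e2; have [_ /(_ _ e2)[U CU hU]] := BC _ BS.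
exists U => // x; apply: le_trans (hnorm_triangle (S x) _ _) _.
by have := hS x; have := hU x; lra.
Qed.

Section Closure.
Variables (B : set (V -> V)) (Balg : star_subalgebra ip B).

Let Bb S : B S -> bounded_op ip S.
Proof. by case: Balg => h _ _ _ _; apply: h. Qed.

Lemma op_closure_comp S T : op_closure ip B S -> op_closure ip B T ->
  op_closure ip B (S \o T).
Proof.
move=> [Sb hS] [Tb hT]; split=> [|e e0]; first exact: bounded_op_comp.
have [M M0 hM] := bounded_opP Tb.
have [|S' BS' hS'] := hS (e / (2 * (M + 1))); first by rewrite divr_gt0//; lra.
have [N N0 hN] := bounded_opP (Bb BS').
(* [T'] is chosen after [S'] because its tolerance involves the bound [N] of [S'], in view of
   [S T - S' T' = (S - S') T + S' (T - T')]. *)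
have [|T' BT' hT'] := hT (e / (2 * (N + 1))); first by rewrite divr_gt0//; lra.
exists (S' \o T'); first by case: Balg => _ _ _ h _; apply: h.
move=> x /=; apply: le_trans (hnorm_triangle (S' (T x)) _ _) _.
rewrite -(bopB (Bb BS')).
have h1 : hnorm (S (T x) - S' (T x)) <= e / 2 * hnorm x.
  apply: le_trans (hS' _) _.
  apply: (@le_trans _ _ (e / (2 * (M + 1)) * ((M + 1) * hnorm x))).
    rewrite ler_wpM2l//; first by rewrite divr_ge0//; lra.
    by apply: le_trans (hM x) _; rewrite ler_wpM2r ?hnorm_ge0//; lra.
  by rewrite mulrA le_eqVlt; apply/orP; left; apply/eqP; field; lra.
have h2 : hnorm (S' (T x - T' x)) <= e / 2 * hnorm x.
  apply: le_trans (hN _) _.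
  apply: (@le_trans _ _ ((N + 1) * (e / (2 * (N + 1)) * hnorm x))).
    by rewrite ler_pM ?hnorm_ge0//; lra.
  by rewrite mulrA le_eqVlt; apply/orP; left; apply/eqP; field; lra.
lra.
Qed.

Lemma op_closure_lin a S T : op_closure ip B S -> op_closure ip B T ->
  op_closure ip B (fun x => a *: S x + T x).
Proof.
move=> [Sb hS] [Tb hT]; split=> [|e e0]; first exact: bounded_op_lin.
have a0 := normc_ge0 a.
have [|S' BS' hS'] := hS (e / (2 * (normc a + 1))); first by rewrite divr_gt0//; lra.
have [|T' BT' hT'] := hT (e / 2); first by rewrite divr_gt0.
exists (fun x => a *: S' x + T' x); first by case: Balg => _ _ h _ _; apply: h.
move=> x; rewrite opprD addrACA -scalerBr; apply: le_trans (hnormD _ _) _.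
rewrite hnormZ; have h1 : normc a * hnorm (S x - S' x) <= e / 2 * hnorm x.
  apply: (@le_trans _ _ ((normc a + 1) * (e / (2 * (normc a + 1)) * hnorm x))).
    by rewrite ler_pM ?hnorm_ge0//; lra.
  by rewrite mulrA le_eqVlt; apply/orP; left; apply/eqP; field; lra.
by have := hT' x; lra.
Qed.

(* The adjoints of operators approaching T are Cauchy in operator norm, because
   taking adjoints is isometric; their limit is the adjoint of T. *)
Lemma op_closure_adjoint T : op_closure ip B T ->
  exists2 T', op_closure ip B T' & adjoint_pair ip T T'.
Proof.
move=> [Tb hT]; pose eps n : R := n.+1%:R^-1.
have eps0 n : 0 < eps n by rewrite invr_gt0.
have /choice[S hS] n : exists S, B S /\
    forall x, hnorm (T x - S x) <= eps n * hnorm x.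
  by have [S BS h] := hT _ (eps0 n); exists S.
have /choice[S' hS'] n : exists S', B S' /\ adjoint_pair ip (S n) S'.
  by case: Balg => _ _ _ _ h; have [S' BS' SS'] := h _ (hS n).1; exists S'.
(* [S n] and [S m] are both close to [T], and the passage to adjoints preserves the bound on their
   difference. *)
have cauchy n m x : hnorm (S' n x - S' m x) <= (eps n + eps m) * hnorm x.
  apply: (@adjoint_norm_le (fun x => S n x - S m x) (fun x => S' n x - S' m x)).
  - by have := eps0 n; have := eps0 m; lra.
  - by move=> y z; rewrite ipBl ipBr (hS' n).2 (hS' m).2.
  - move=> y; apply: le_trans (hnorm_triangle (T y) _ _) _.
    by rewrite hnormBC; have := (hS n).2 y; have := (hS m).2 y; lra.
have /choice[T' hT'] x : exists l, hcvg ip (fun n => S' n x) l.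
  case: hilb => _ _ _; apply=> e e0.
  have x1 : 0 < hnorm x + 1 by have := hnorm_ge0 x; lra.
  have [N hN] := @ex_inv_nat R (e / (2 * (hnorm x + 1))) ltac:(by rewrite divr_gt0//; lra).
  have le_eps n : (N <= n)%N -> eps n <= eps N.
    by move=> Nn; rewrite lef_pV2 ?posrE// ler_nat ltnS.
  exists N => m n Nm Nn; apply: le_lt_trans (cauchy m n x) _.
  apply: (@le_lt_trans _ _ ((2 * eps N) * hnorm x)).
    by rewrite ler_wpM2r ?hnorm_ge0//; have := le_eps _ Nm; have := le_eps _ Nn; lra.
  apply: (@le_lt_trans _ _ ((2 * eps N) * (hnorm x + 1))).
    by rewrite ler_wpM2l//; [have := eps0 N|]; lra.
  rewrite -ltr_pdivlMr//; move: hN; rewrite -/(eps N).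
  have -> : e / (2 * (hnorm x + 1)) = (e / (hnorm x + 1)) / 2 by field; lra.
  lra.
have lim n x : hnorm (T' x - S' n x) <= eps n * hnorm x.
  (* Going through [S' k x] with [k] large costs [e] for the convergence and [e * hnorm x] for
     [eps k], hence the factor [1 + hnorm x]. *)
  rewrite -subr_le0; apply: (@le_eps_mul _ _ (1 + hnorm x)).
    by have := hnorm_ge0 x; lra.
  move=> e e0; have /hcvgP/(_ e e0)[N hN] := hT' x.
  have [m hm] := ex_inv_nat e0; pose k := maxn N m.
  have km : eps k <= e.
    by apply: le_trans (ltW hm); rewrite lef_pV2 ?posrE// ler_nat ltnS leq_maxr.
  have := hnorm_triangle (S' k x) (T' x) (S' n x).
  have := cauchy k n x; have := hN k (leq_maxl _ _); rewrite hnormBC.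
  have : eps k * hnorm x <= e * hnorm x by rewrite ler_wpM2r ?hnorm_ge0.
  lra.
have TT' : adjoint_pair ip T T'.
  apply: adjoint_pair_Re => [|x y]; first exact: bopZ.
  apply/eqP; rewrite -subr_eq0 -normr_le0.
  apply: (@le_eps_mul _ _ (2 * (hnorm x * hnorm y))).
    by rewrite !mulr_ge0 ?hnorm_ge0.
  move=> e e0; have [n hn] := ex_inv_nat e0.
  have -> : Re (ip (T x) y) - Re (ip x (T' y)) =
      Re (ip (T x - S n x) y) - Re (ip x (T' y - S' n y)).
    by rewrite ipBl ipBr (hS' n).2 !ReD !ReN; ring.
  apply: le_trans (ler_normB _ _) _.
  have h1 := normr_Re_ip_le (T x - S n x) y.
  have h2 := normr_Re_ip_le x (T' y - S' n y).
  have h3 : hnorm (T x - S n x) * hnorm y <= e * (hnorm x * hnorm y).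
    rewrite mulrA ler_wpM2r ?hnorm_ge0//; apply: le_trans ((hS n).2 x) _.
    by rewrite ler_wpM2r ?hnorm_ge0// ltW.
  have h4 : hnorm x * hnorm (T' y - S' n y) <= e * (hnorm x * hnorm y).
    rewrite mulrCA ler_wpM2l ?hnorm_ge0//; apply: le_trans (lim n y) _.
    by rewrite ler_wpM2r ?hnorm_ge0// ltW.
  lra.
exists T' => //; split; first exact: adjoint_bounded TT'.
move=> e e0; have [n hn] := ex_inv_nat e0.
exists (S' n); first exact: (hS' n).1.
by move=> x; apply: le_trans (lim n x) _; rewrite ler_wpM2r ?hnorm_ge0// ltW.
Qed.

Lemma cstar_op_closure : cstar_algebra ip (op_closure ip B).
Proof.
split; last exact: op_closure_min.
split; first by move=> T [].
- by apply: subset_op_closure => //; case: Balg.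
- exact: op_closure_lin.
- exact: op_closure_comp.
- exact: op_closure_adjoint.
Qed.

End Closure.
End Hilbert.

(** * The Hilbert spaces and the multiplication operators *)

Lemma real_cauchy_cvg (R : realType) (w : nat -> R) :
  (forall e, 0 < e -> exists N, forall m n, (N <= m)%N -> (N <= n)%N ->
     `|w m - w n| < e) ->
  cvg (w @ \oo).
Proof.
move=> h; apply: cauchy_cvg; apply/cauchy_exP => e e0.
have [N hN] := h e e0; exists (w N), N => // n Nn.
by rewrite /ball/=; exact: hN.
Qed.

Section TailSums.
Variables (R : realType) (L : zmodType).

Lemma nsum_tail (p : L -> R) e : (forall x, 0 <= p x) -> summ p -> 0 < e ->
  exists X : {fset L}, nsum (fun x => if x \in X then 0 else p x) < e.
Proof.
move=> p0 ps e0; have [X hX] := nsum_approx p0 ps e0; exists X.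
have hin x : 0 <= (if x \in X then p x else 0) by case: ifP.
have hout x : 0 <= (if x \in X then 0 else p x) by case: ifP.
have sin : summ (fun x => if x \in X then p x else 0).
  by apply: le_summ ps => x; case: ifP.
have sout : summ (fun x => if x \in X then 0 else p x).
  by apply: le_summ ps => x; case: ifP.
have : nsum p = nsum (fun x => if x \in X then p x else 0) +
                nsum (fun x => if x \in X then 0 else p x).
  rewrite -nsumD//; apply: eq_nsum => x.
  by case: ifP; rewrite ?addr0 ?add0r.
have [||_ ->] := @summ_fin_supp _ _ (fun x => if x \in X then p x else 0) X => //.
  by move=> x /negPf ->.
rewrite (eq_big_seq p); last by move=> x ->.
lra.
Qed.

End TailSums.

(** * The Hilbert space l2 and multiplication by real functions *)

Section L2.
Variables (R : realType) (L : zmodType).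
Local Notation H := (l2 R L).
Local Notation normc := Normc.normc.
Local Notation Re := complex.Re.
Local Notation Im := complex.Im.
Local Notation ip := (@l2_ip R L).
Implicit Types (a b d : H) (x y : L).

Lemma in_l2P a : in_l2 a.
Proof. by have := valP a => /asboolP. Qed.

Lemma to_l2K (u : L -> R[i]) : in_l2 u -> to_l2 u = u :> (L -> R[i]).
Proof. by move=> hu; rewrite -[LHS]/(val _) insubdK//; apply/asboolP. Qed.

Lemma to_l2_fun a : to_l2 a = a.
Proof. by apply: val_inj; exact: to_l2K (in_l2P a). Qed.

Lemma l2_ext a b : (forall x, a x = b x) -> a = b.
Proof. by move=> h; apply: val_inj; apply/funext. Qed.

Lemma l2DE a b x : (a + b) x = a x + b x.
Proof. by []. Qed.

Lemma l2NE a x : (- a) x = - a x.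
Proof. by []. Qed.

Lemma l2ZE s a x : (s *: a) x = s * a x.
Proof. by []. Qed.

Lemma l2BE a b x : (a - b) x = a x - b x.
Proof. by []. Qed.

Lemma in_l2_lin s (u w : L -> R[i]) : in_l2 u -> in_l2 w ->
  in_l2 (fun x => s * u x + w x).
Proof.
move=> hu hw; have [_ h] := l2_submod_closed R L.
by apply/asboolP; apply: h; apply/asboolP.
Qed.

Lemma in_l20 : in_l2 (fun _ : L => 0 : R[i]).
Proof. exact: in_l2P 0. Qed.

Lemma le_in_l2 (u w : L -> R[i]) M : (forall x, normc (u x) <= M * normc (w x)) ->
  in_l2 w -> in_l2 u.
Proof.
move=> h hw; rewrite /in_l2/=; apply: le_summ; last first.
  by apply: (@summZ _ _ _ (M ^+ 2)) hw; [move=> x; exact: sqr_ge0|exact: sqr_ge0].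
move=> x /=; rewrite -exprMn lerXn2r ?nnegrE ?normc_ge0//.
by rewrite (le_trans _ (h x))// normc_ge0.
Qed.

Lemma to_l2_lin s (u w : L -> R[i]) : in_l2 u -> in_l2 w ->
  to_l2 (fun x => s * u x + w x) = s *: to_l2 u + to_l2 w.
Proof.
move=> hu hw; apply: l2_ext => x.
by rewrite l2DE l2ZE !to_l2K//; exact: in_l2_lin.
Qed.

Lemma summc_l2_mul (u w : L -> R[i]) : in_l2 u -> in_l2 w ->
  summc (fun x => u x * (w x)^* ).
Proof.
move=> hu hw; have n0 (z : L -> R[i]) x : 0 <= normc (z x) ^+ 2 by exact: sqr_ge0.
apply: le_summ (summD (n0 u) (n0 w) hu hw) => x.
rewrite Normc.normcM normc_conj.
have := sqr_ge0 (normc (u x) - normc (w x)).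
have := sqr_ge0 (normc (u x)); have := sqr_ge0 (normc (w x)).
by rewrite sqrrB; lra.
Qed.

Lemma l2_ip_sqr a : ip a a = real_complex R (nsum (fun x => normc (a x) ^+ 2)).
Proof.
rewrite -csum_real; last exact: in_l2P.
  by apply: eq_csum => x; rewrite mul_conj_normc.
by move=> x; exact: sqr_ge0.
Qed.

Lemma l2_sqr_hnorm a : hnorm ip a ^+ 2 = nsum (fun x => normc (a x) ^+ 2).
Proof.
rewrite sqr_sqrtr ?l2_ip_sqr//=.
by apply: nsum_ge0 => x; exact: sqr_ge0.
Qed.

Lemma l2_hnorm_ge0 a : 0 <= hnorm ip a.
Proof. exact: sqrtr_ge0. Qed.

Lemma l2_coord_le a x : normc (a x) <= hnorm ip a.
Proof.
rewrite -(@ler_pXn2r _ 2)// ?nnegrE ?normc_ge0 ?l2_hnorm_ge0//.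
rewrite l2_sqr_hnorm.
apply: (@le_nsum1 _ _ (fun x => normc (a x) ^+ 2)); last exact: in_l2P.
by move=> y; exact: sqr_ge0.
Qed.

Lemma l2_hnorm_le a M : 0 <= M ->
  (forall X : {fset L}, \sum_(x <- X) normc (a x) ^+ 2 <= M ^+ 2) ->
  hnorm ip a <= M.
Proof.
move=> M0 h; rewrite -(@ler_pXn2r _ 2)// ?nnegrE ?l2_hnorm_ge0//.
rewrite l2_sqr_hnorm; apply: (nsum_le h _).2 => x; exact: sqr_ge0.
Qed.

(** A Fatou argument: for each finite set the partial sum of squares is at most [e ^+ 2] for large
    [m], the bound survives the limit in [m], and then the finite set is arbitrary. *)
Lemma l2_pointwise_lim (u : nat -> H) (l : L -> R[i]) n e : 0 <= e ->
  (forall x, (fun m => Re (u m x)) @ \oo --> Re (l x)) ->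
  (forall x, (fun m => Im (u m x)) @ \oo --> Im (l x)) ->
  (exists N, forall m, (N <= m)%N -> hnorm ip (u n - u m) <= e) ->
  in_l2 (fun x => u n x - l x) /\ hnorm ip (to_l2 (fun x => u n x - l x)) <= e.
Proof.
move=> e0 hRe hIm [N hN].
have nE (z : R[i]) : normc z ^+ 2 = Re z * Re z + Im z * Im z.
  by case: z => r s /=; rewrite sqr_sqrtr ?addr_ge0 ?sqr_ge0.
have hX (X : {fset L}) : \sum_(x <- X) normc (u n x - l x) ^+ 2 <= e ^+ 2.
  have lim : (fun m => \sum_(x <- X) normc (u n x - u m x) ^+ 2) @ \oo -->
      \sum_(x <- X) normc (u n x - l x) ^+ 2.
    apply: cvg_big => [|x _]; first exact: add_continuous.
    rewrite nE; under eq_fun do rewrite nE.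
    rewrite !ReD !ImD !ReN !ImN; under eq_fun do rewrite !ReD !ImD !ReN !ImN.
    by apply: cvgD; apply: cvgM; apply: cvgB => //; exact: cvg_cst.
  apply: (closed_cvg (fun r => r <= e ^+ 2) _ _ _ lim).
    exact: (@closed_le R (e ^+ 2)).
  exists N => // m Nm /=.
  apply: (@le_trans _ _ (hnorm ip (u n - u m) ^+ 2)); last first.
    by rewrite lerXn2r ?nnegrE ?l2_hnorm_ge0//; exact: hN.
  rewrite l2_sqr_hnorm.
  apply: (@sum_le_nsum _ _ (fun x => normc ((u n - u m) x) ^+ 2)).
    by move=> x; exact: sqr_ge0.
  exact: in_l2P.
have dl : in_l2 (fun x => u n x - l x).
  by apply: (nsum_le hX _).1 => x; exact: sqr_ge0.
split=> //; apply: l2_hnorm_le => // X.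
by rewrite (to_l2K dl).
Qed.

Lemma l2_hilbert : is_hilbert ip.
Proof.
split.
- move=> s a b d; rewrite /l2_ip -csumZ; last exact: summc_l2_mul (in_l2P _) (in_l2P _).
  rewrite -csumD; last 2 first.
  - by apply: summcZ; exact: summc_l2_mul (in_l2P _) (in_l2P _).
  - exact: summc_l2_mul (in_l2P _) (in_l2P _).
  by apply: eq_csum => x; rewrite l2DE l2ZE mulrDl mulrA.
- move=> a b; rewrite /l2_ip -csumJ; apply: eq_csum => x.
  by rewrite rmorphM/= conjCK mulrC.
- move=> a a0; rewrite l2_ip_sqr ltcE/= eqxx/=.
  have [x ax] : exists x, a x != 0.
    apply: contrapT => h; move/negP: a0; apply; apply/eqP; apply: l2_ext => x.
    by apply: contrapT => /eqP ax; apply: h; exists x.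
  apply: (@lt_le_trans _ _ (normc (a x) ^+ 2)).
    rewrite exprn_gt0// lt_neqAle normc_ge0 andbT eq_sym.
    by apply: contra ax => /eqP/Normc.eq0_normc ->.
  apply: (@le_nsum1 _ _ (fun x => normc (a x) ^+ 2)); last exact: in_l2P.
  by move=> y; exact: sqr_ge0.
- move=> u hu.
  have hc x m n : normc (u m x - u n x) <= hnorm ip (u m - u n).
    exact: (l2_coord_le (u m - u n)).
  have cRe x : cvg ((fun m => Re (u m x)) @ \oo).
    apply: real_cauchy_cvg => e e0; have [N hN] := hu e e0; exists N => m n Nm Nn.
    rewrite -ReN -ReD; apply: le_lt_trans (Re_le_normc _) _.
    exact: le_lt_trans (hc x m n) (hN m n Nm Nn).
  have cIm x : cvg ((fun m => Im (u m x)) @ \oo).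
    apply: real_cauchy_cvg => e e0; have [N hN] := hu e e0; exists N => m n Nm Nn.
    rewrite -ImN -ImD; apply: le_lt_trans (Im_le_normc _) _.
    exact: le_lt_trans (hc x m n) (hN m n Nm Nn).
  (* Evaluation at a point is contractive, so a Cauchy sequence converges coordinatewise; this is
     the only candidate for its limit. *)
  pose l x : R[i] := ((lim ((fun m => Re (u m x)) @ \oo)) +i*
                      (lim ((fun m => Im (u m x)) @ \oo)))%C.
  have key e : 0 < e -> exists N, forall n, (N <= n)%N ->
      in_l2 (fun x => u n x - l x) /\
      hnorm ip (to_l2 (fun x => u n x - l x)) <= e.
    move=> e0; have [N hN] := hu e e0; exists N => n Nn.
    apply: l2_pointwise_lim; [exact: ltW|exact: cRe|exact: cIm|].
    by exists N => m Nm; apply/ltW/hN.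
  have ll : in_l2 l.
    have [N hN] := key 1 ltr01; have [hl _] := hN N (leqnn N).
    (* The limit is [u N] minus the square summable difference [u N - l]. *)
    have := in_l2_lin (-1) hl (in_l2P (u N)).
    by congr in_l2; apply/funext => x; rewrite mulN1r opprB subrK.
  exists (to_l2 l); apply/(hcvgP ip) => e e0.
  have [N hN] := key (e / 2) ltac:(lra); exists N => n Nn.
  have [h1 h2] := hN n Nn; apply: (@le_lt_trans _ _ (e / 2)); last by lra.
  suff -> : u n - to_l2 l = to_l2 (fun x => u n x - l x) by [].
  by apply: l2_ext => x; rewrite l2BE !to_l2K.
Qed.

Definition trunc (X : {fset L}) (u : L -> R[i]) x : R[i] :=
  if x \in X then u x else 0.

Lemma in_l2_fin_supp (X : {fset L}) (u : L -> R[i]) :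
  (forall x, x \notin X -> u x = 0) -> in_l2 u.
Proof.
move=> h; apply: (summ_fin_supp (X := X) _ _).1 => x; last exact: sqr_ge0.
by move=> /h ->; rewrite Normc.normc0 expr0n.
Qed.

Lemma in_l2_trunc X u : in_l2 (trunc X u).
Proof. by apply: (@in_l2_fin_supp X) => x /negPf xX; rewrite /trunc xX. Qed.

Lemma l2_trunc_approx a e : 0 < e ->
  exists X, hnorm ip (a - to_l2 (trunc X a)) < e.
Proof.
move=> e0; have [|||X hX] := @nsum_tail _ _ (fun x => normc (a x) ^+ 2) (e ^+ 2).
- by move=> x; exact: sqr_ge0.
- exact: in_l2P.
- exact: exprn_gt0.
exists X; rewrite -(@ltr_pXn2r _ 2)// ?nnegrE ?l2_hnorm_ge0 ?(ltW e0)//.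
rewrite l2_sqr_hnorm; apply: le_lt_trans hX; rewrite le_eqVlt; apply/orP; left.
apply/eqP/eq_nsum => x; rewrite l2BE (to_l2K (in_l2_trunc _ _)) /trunc.
by case: ifP; rewrite ?subrr ?subr0// Normc.normc0 expr0n.
Qed.

Definition delta x y : R[i] := (y == x)%:R.

Lemma in_l2_delta x : in_l2 (delta x).
Proof.
by apply: (@in_l2_fin_supp [fset x]%fset) => y; rewrite inE /delta => /negPf ->.
Qed.

Lemma l2_ip_delta x a : ip (to_l2 (delta x)) a = (a x)^*.
Proof.
rewrite /l2_ip (csum_supp1 (x := x)) (to_l2K (in_l2_delta x)) /delta.
  by rewrite eqxx mul1r.
by move=> y /negPf ->; rewrite mul0r.
Qed.

Section Multiplication.
Variable h : L -> R.
Local Notation hm := (Defs.mul_fun h).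

Lemma mul_fun_lin s (u w : L -> R[i]) :
  hm (fun x => s * u x + w x) = (fun x => s * hm u x + hm w x).
Proof. by apply/funext => x; rewrite /Defs.mul_fun mulrDr !mulrA (mulrC s). Qed.

Lemma in_l2_mul_lin s (a b : H) : in_l2 (hm a) -> in_l2 (hm b) ->
  in_l2 (hm (s *: a + b)).
Proof.
move=> ha hb; rewrite (_ : hm _ = (fun x => s * hm a x + hm b x)).
  exact: in_l2_lin.
exact: mul_fun_lin.
Qed.

Lemma to_l2_mul_lin s (a b : H) : in_l2 (hm a) -> in_l2 (hm b) ->
  to_l2 (hm (s *: a + b)) = s *: to_l2 (hm a) + to_l2 (hm b).
Proof.
move=> ha hb; rewrite -to_l2_lin//; congr to_l2; exact: mul_fun_lin.
Qed.

Lemma mul_fun0 : hm (0 : H) = (fun=> 0).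
Proof. by apply/funext => x; rewrite /Defs.mul_fun mulr0. Qed.

(** Finitely supported vectors lie in the domain of every multiplication operator, whatever the
    growth of [h]; this gives the density of the domain. *)
Lemma in_l2_mul_trunc X (a : H) : in_l2 (hm (to_l2 (trunc X a))).
Proof.
apply: (@in_l2_fin_supp X) => x xX.
by rewrite /Defs.mul_fun (to_l2K (in_l2_trunc _ _)) /trunc (negPf xX) mulr0.
Qed.

Lemma l2_ip_mul (a b : H) : in_l2 (hm a) -> in_l2 (hm b) ->
  ip (to_l2 (hm a)) b = ip a (to_l2 (hm b)).
Proof.
move=> ha hb; apply: eq_csum => x; rewrite !to_l2K// /Defs.mul_fun rmorphM/=.
by rewrite -[X in _ = _ * (X * _)]/(conjc _) conjc_real mulrCA mulrA.
Qed.

(* Testing against the point masses recovers h b = d pointwise. *)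
Lemma mul_fun_adjoint (b d : H) :
  (in_l2 (hm b) /\ to_l2 (hm b) = d) <->
  (forall a : H, in_l2 (hm a) -> ip (to_l2 (hm a)) b = ip a d).
Proof.
split=> [[hb <-] a ha|hbd]; first exact: l2_ip_mul.
have e : hm b = d.
  apply/funext => x; have hd : in_l2 (hm (to_l2 (delta x))).
    apply: (@in_l2_fin_supp [fset x]%fset) => y; rewrite inE => /negPf yx.
    by rewrite /Defs.mul_fun (to_l2K (in_l2_delta x)) /delta yx mulr0.
  have := hbd _ hd; rewrite l2_ip_delta.
  have -> : to_l2 (hm (to_l2 (delta x))) = real_complex R (h x) *: to_l2 (delta x).
    apply: l2_ext => y; rewrite l2ZE (to_l2K hd) /Defs.mul_fun (to_l2K (in_l2_delta x)).
    by rewrite /delta; case: eqP => [->//|_]; rewrite !mulr0.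
  case: l2_hilbert => ipl _ _ _.
  rewrite -[X in ip X _]addr0 ipl (ip0l l2_hilbert) addr0 l2_ip_delta => hx.
  apply: (can_inj (@conjCK R[i])); rewrite -hx /Defs.mul_fun rmorphM/=.
  by rewrite -[X in X * _ = _]/(conjc _) conjc_real.
have hb : in_l2 (hm b) by rewrite e; exact: in_l2P.
by split=> //; rewrite e; exact: to_l2_fun.
Qed.

End Multiplication.
End L2.

(** * Bounded and positive multiplication operators *)

Section BoundedMultiplication.
Variables (R : realType) (L : zmodType).
Local Notation H := (l2 R L).
Local Notation ip := (@l2_ip R L).

Lemma l2_hnorm_le_fun (a b : H) M : 0 <= M ->
  (forall x, Normc.normc (a x) <= M * Normc.normc (b x)) ->
  hnorm ip a <= M * hnorm ip b.
Proof.
move=> M0 h; rewrite -(@ler_pXn2r _ 2)// ?nnegrE ?mulr_ge0 ?l2_hnorm_ge0//.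
have sq (d : H) x : 0 <= Normc.normc (d x) ^+ 2 by exact: sqr_ge0.
rewrite exprMn !l2_sqr_hnorm -nsumZ ?sqr_ge0//; last exact: in_l2P.
apply: le_nsum => //; last first.
  by apply: summZ; [exact: sq|exact: sqr_ge0|exact: in_l2P].
move=> x; rewrite -exprMn lerXn2r ?nnegrE ?normc_ge0//.
by rewrite (le_trans _ (h x))// normc_ge0.
Qed.

Lemma normc_mul_fun (h : L -> R) (u : L -> R[i]) x :
  Normc.normc (Defs.mul_fun h u x) = `|h x| * Normc.normc (u x).
Proof. by rewrite Normc.normcM normc_real. Qed.

Lemma in_l2_bounded_mul (g : L -> R) M (u : L -> R[i]) :
  (forall x, `|g x| <= M) -> in_l2 u -> in_l2 (Defs.mul_fun g u).
Proof.
move=> gM; apply: le_in_l2 => x; rewrite normc_mul_fun.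
by apply: ler_wpM2r => //; exact: normc_ge0.
Qed.

Lemma bounded_op_mul (g : L -> R) M : (forall x, `|g x| <= M) ->
  bounded_op ip (fun b => to_l2 (Defs.mul_fun g b)).
Proof.
move=> gM; have gl2 (a : H) := in_l2_bounded_mul gM (in_l2P a).
split=> [s a b|]; first exact: to_l2_mul_lin.
have M0 : 0 <= M := le_trans (normr_ge0 (g 0)) (gM 0).
exists M => a; apply: l2_hnorm_le_fun => // x.
by rewrite (to_l2K (gl2 a)) normc_mul_fun ler_wpM2r// normc_ge0.
Qed.

Lemma l2_ip_mul_ge0 (h : L -> R) (a : H) : (forall x, 0 <= h x) ->
  in_l2 (Defs.mul_fun h a) -> 0 <= ip (to_l2 (Defs.mul_fun h a)) a.
Proof.
move=> h0 ha; have -> : ip (to_l2 (Defs.mul_fun h a)) a =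
    csum (fun x => real_complex R (h x * Normc.normc (a x) ^+ 2)).
  apply: eq_csum => x; rewrite (to_l2K ha) /Defs.mul_fun -mulrA.
  by rewrite mul_conj_normc -rmorphM.
have p0 x : 0 <= h x * Normc.normc (a x) ^+ 2 by rewrite mulr_ge0 ?sqr_ge0.
rewrite csum_real//; first by rewrite lecR nsum_ge0.
apply: le_summ (summc_l2_mul ha (in_l2P a)) => x.
by rewrite Normc.normcM normc_conj normc_mul_fun ger0_norm// -mulrA -expr2.
Qed.

Definition mulop (h : L -> R) : unbounded H :=
  Unbounded [set b : H | in_l2 (Defs.mul_fun h b)]
    (fun b => to_l2 (Defs.mul_fun h b)).

End BoundedMultiplication.

(** * Two copies of l2: the operator [D], its absolute value and the grading *)

Section DirectSum.
Variables (R : realType) (L : zmodType).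
Local Notation H := (l2 R L).
Local Notation W := (H * H)%type.
Local Notation ip := (@l2_ip R L).
Local Notation dip := (@dsum_ip R L).
Local Notation hm := Defs.mul_fun.
Implicit Types p q : W.

Lemma Re_l2_ip_ge0 (a : H) : 0 <= complex.Re (ip a a).
Proof. by rewrite -(sqr_hnorm (@l2_hilbert R L)) sqr_ge0. Qed.

Lemma dsum_sqr_hnorm p : hnorm dip p ^+ 2 = hnorm ip p.1 ^+ 2 + hnorm ip p.2 ^+ 2.
Proof.
rewrite !(sqr_hnorm (@l2_hilbert R L)) sqr_sqrtr ReD//.
by rewrite addr_ge0 ?Re_l2_ip_ge0.
Qed.

Lemma dsum_hnorm_ge0 p : 0 <= hnorm dip p.
Proof. exact: sqrtr_ge0. Qed.

Lemma dsum_hnorm1 p : hnorm ip p.1 <= hnorm dip p.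
Proof.
rewrite -(@ler_pXn2r _ 2)// ?nnegrE ?l2_hnorm_ge0 ?dsum_hnorm_ge0//.
by rewrite dsum_sqr_hnorm lerDl sqr_ge0.
Qed.

Lemma dsum_hnorm2 p : hnorm ip p.2 <= hnorm dip p.
Proof.
rewrite -(@ler_pXn2r _ 2)// ?nnegrE ?l2_hnorm_ge0 ?dsum_hnorm_ge0//.
by rewrite dsum_sqr_hnorm lerDr sqr_ge0.
Qed.

Lemma dsum_hnorm_le p : hnorm dip p <= hnorm ip p.1 + hnorm ip p.2.
Proof.
rewrite -(@ler_pXn2r _ 2)// ?nnegrE ?addr_ge0 ?l2_hnorm_ge0 ?dsum_hnorm_ge0//.
rewrite dsum_sqr_hnorm sqrrD addrAC lerDl mulrn_wge0// mulr_ge0//.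
  exact: l2_hnorm_ge0.
exact: l2_hnorm_ge0.
Qed.

Lemma dsum_hcvg (u : nat -> W) (l1 l2 : H) : hcvg ip (fun n => (u n).1) l1 ->
  hcvg ip (fun n => (u n).2) l2 -> hcvg dip u (l1, l2).
Proof.
move=> /hcvgP h1 /hcvgP h2; apply/hcvgP => e e0; have e2 : 0 < e / 2 by lra.
have [N1 hN1] := h1 _ e2; have [N2 hN2] := h2 _ e2.
exists (maxn N1 N2) => n; rewrite geq_max => /andP[n1 n2].
apply: le_lt_trans (dsum_hnorm_le _) _ => /=.
by have := hN1 n n1; have := hN2 n n2; lra.
Qed.

Lemma dsum_hilbert : is_hilbert dip.
Proof.
have [ipl ipc ip0 ipcomp] := @l2_hilbert R L.
split.
- by move=> s x y z; rewrite /dsum_ip !ipl mulrDr addrACA.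
- by move=> x y; rewrite /dsum_ip (ipc x.1) (ipc x.2) rmorphD.
- move=> [a b] ab0; rewrite /dsum_ip/=.
  have [a0|a0] := eqVneq a 0.
    rewrite a0 (ip0l (@l2_hilbert R L)) add0r ip0//.
    by apply: contra ab0 => /eqP ->; rewrite a0.
  have := ip0 a a0; have [->|b0] := eqVneq b 0.
    by rewrite (ip0l (@l2_hilbert R L)) addr0.
  by move=> h1; rewrite addr_gt0// ip0.
- move=> u hu.
  have [e e0|l1 hl1] := ipcomp (fun n => (u n).1).
    have [N hN] := hu e e0; exists N => m n Nm Nn.
    exact: le_lt_trans (dsum_hnorm1 (u m - u n)) (hN m n Nm Nn).
  have [e e0|l2 hl2] := ipcomp (fun n => (u n).2).
    have [N hN] := hu e e0; exists N => m n Nm Nn.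
    exact: le_lt_trans (dsum_hnorm2 (u m - u n)) (hN m n Nm Nn).
  by exists (l1, l2); exact: dsum_hcvg.
Qed.

(** The boolean allows one statement to cover [D] and its absolute value, and operators of either
    parity for the grading; composing flips adds the booleans. *)
Definition swap_if (s : bool) p : W := if s then (p.2, p.1) else p.

Lemma swap_ifK s : involutive (swap_if s).
Proof. by case: s => -[]. Qed.

Lemma dsum_ip_swap s p q : dip (swap_if s p) q = dip p (swap_if s q).
Proof. by case: s => //; rewrite /dsum_ip/= addrC. Qed.

Lemma hnorm_swap s p : hnorm dip (swap_if s p) = hnorm dip p.
Proof. by rewrite /hnorm dsum_ip_swap swap_ifK. Qed.

Lemma swap_if_lin s a p q : swap_if s (a *: p + q) = a *: swap_if s p + swap_if s q.
Proof. by case: s. Qed.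

Definition swap_diag s (T : H -> H) p : W := swap_if s (diag_action T p).

Lemma bounded_swap_diag s T : bounded_op ip T -> bounded_op dip (swap_diag s T).
Proof.
move=> Tb; have [Tl _] := Tb; split=> [a p q|].
  by rewrite -swap_if_lin /swap_diag /diag_action/= !Tl.
have [M M0 hM] := bounded_opP Tb.
exists (M + M) => p; rewrite hnorm_swap; apply: le_trans (dsum_hnorm_le _) _.
rewrite mulrDl; apply: lerD; apply: le_trans (hM _) _; rewrite ler_wpM2l//.
  exact: dsum_hnorm1.
exact: dsum_hnorm2.
Qed.

(* [swap_mul true h] is [offdiag h], and [swap_mul false h] its absolute value. *)
Definition swap_mul s (h : L -> R) : unbounded W :=
  Unbounded (udom (offdiag h))
    (fun p => swap_if s (to_l2 (hm h p.1), to_l2 (hm h p.2))).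

Lemma swap_mul_dom s t h p : udom (swap_mul s h) (swap_if t p) <->
  udom (swap_mul s h) p.
Proof. by case: t => //=; tauto. Qed.

Lemma swap_mul_selfadjoint s h : selfadjoint dip (swap_mul s h).
Proof.
have l0 : in_l2 (hm h (0 : H)) by rewrite mul_fun0; exact: in_l20.
split.
- split=> [|a p q [p1 p2] [q1 q2]]; first by split.
  split; first by split; exact: in_l2_mul_lin.
  by rewrite -swap_if_lin /=; congr swap_if; rewrite !to_l2_mul_lin.
- move=> p e e0; have e2 : 0 < e / 2 by lra.
  have [X hX] := l2_trunc_approx p.1 e2; have [Y hY] := l2_trunc_approx p.2 e2.
  exists (to_l2 (trunc X p.1), to_l2 (trunc Y p.2)).
    by split; exact: in_l2_mul_trunc.
  apply: le_lt_trans (dsum_hnorm_le _) _; rewrite (splitr e).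
  exact: ltrD hX hY.
- move=> p q; split=> [[[p1 p2] <-] r [r1 r2]|hpq].
    rewrite -[RHS]dsum_ip_swap /dsum_ip /=.
    by case: s => /=; rewrite !l2_ip_mul// addrC.
  have ip0 := ip0l (@l2_hilbert R L).
  have t0 : to_l2 (hm h (0 : H)) = 0.
    by rewrite mul_fun0; apply: l2_ext => x; rewrite to_l2K//; exact: in_l20.
  (* Test vectors supported in one summand decouple the two components, each of which is the adjoint
     problem on a single copy of l2. *)
  have [d1 e1] : in_l2 (hm h (swap_if s p).1) /\
      to_l2 (hm h (swap_if s p).1) = q.1.
    apply/mul_fun_adjoint => a ha; have := hpq (a, 0) (conj ha l0).
    by rewrite dsum_ip_swap /dsum_ip/= t0 !ip0 !addr0.
  have [d2 e2] : in_l2 (hm h (swap_if s p).2) /\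
      to_l2 (hm h (swap_if s p).2) = q.2.
    apply/mul_fun_adjoint => a ha; have := hpq (0, a) (conj l0 ha).
    by rewrite dsum_ip_swap /dsum_ip/= t0 !ip0 !add0r.
  move: d1 d2 e1 e2; case: s {hpq} => /= d1 d2 e1 e2; split=> //.
    by case: q e1 e2 => q1 q2 /= -> ->.
  by case: q e1 e2 => q1 q2 /= -> ->.
Qed.

(** The flip commutes with the multiplication and squares to the identity, so dropping it changes
    neither the square nor its domain; positivity comes from [h >= 0]. *)
Lemma swap_mul_abs h : (forall x, 0 <= h x) ->
  is_abs dip (offdiag h) (swap_mul false h).
Proof.
move=> h0; split; first exact: swap_mul_selfadjoint.
- by move=> p [p1 p2]; rewrite /dsum_ip/= addr_ge0// l2_ip_mul_ge0.
- split=> p /=; first by tauto.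
  by [].
Qed.

Lemma offdiag_grading calA h : calA `<=` bounded_op ip ->
  has_grading dip (@diag_action R L) calA (offdiag h).
Proof.
move=> calAb; have hil := @l2_hilbert R L.
(* The diagonal matrix with entries 1 and -1. *)
exists (fun p => (p.1, - p.2)); split.
- split=> [a p q|]; first by congr pair => /=; rewrite opprD scalerN.
  exists 1 => p; rewrite mul1r -(@ler_pXn2r _ 2)// ?nnegrE ?dsum_hnorm_ge0//.
  by rewrite !dsum_sqr_hnorm/= (hnormN hil).
- split=> [p q|p]; last by case: p => a b /=; rewrite opprK.
  by rewrite /dsum_ip/= (ipNl hil) (ipNr hil).
- move=> T /calAb Tb p; rewrite /diag_action/=; congr pair.
  by rewrite -[- p.2]sub0r (bopB Tb) (bop0 Tb) sub0r.
- move=> p [p1 p2].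
  have hN : hm h (- p.2) = (fun x => -1 * hm h p.2 x + 0).
    by apply/funext => x; rewrite /Defs.mul_fun l2NE mulrN mulN1r addr0.
  split; first by split=> //=; rewrite hN; exact: in_l2_lin p2 (in_l20 R L).
  congr pair => /=; last by rewrite opprK.
  rewrite hN to_l2_lin//; last exact: in_l20.
  by rewrite scaleN1r (to_l2_fun (0 : H)) addr0.
Qed.

(** Flips commute with equal diagonal blocks, so they factor out of the commutator and their
    parities add. Thus [[D, pi a]] is odd, and commuting with the absolute value of [D] preserves
    parity. *)
Lemma diag_comm s t h T T' : commutator ip (mulop h) T T' ->
  commutator dip (swap_mul t h) (swap_diag s T) (swap_diag (s (+) t) T').
Proof.
move=> [Tb T'b Td Tc]; split; try exact: bounded_swap_diag.
  by move=> p [p1 p2]; apply/swap_mul_dom; split; exact: Td.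
move=> p [p1 p2]; have c1 := Tc _ p1; have c2 := Tc _ p2.
by case: s t => -[]; congr pair => /=; rewrite ?c1 ?c2.
Qed.

Lemma ad_dom_swap_diag s h k T : ad_dom ip (mulop h) k T ->
  ad_dom dip (swap_mul false h) k (swap_diag s T).
Proof.
elim: k s T => [|k IH] s T /=; first exact: bounded_swap_diag.
move=> [T' cT' aT']; exists (swap_diag s T'); last exact: IH.
by have := diag_comm s false cT'; rewrite addbF.
Qed.

End DirectSum.

(** * Operators given by a dominated kernel *)

Section Kernels.
Variables (R : realType) (L : zmodType).
Local Notation H := (l2 R L).
Local Notation ip := (@l2_ip R L).
Local Notation normc := Normc.normc.
Local Notation hm := Defs.mul_fun.
Implicit Types (k : L -> L -> R[i]) (g : L -> R) (a b : H) (x y : L).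

(** In [k x y] the second variable is the displacement: [k x y] multiplies the value at [x - y]. The
    bound depends on the displacement only, which makes the operator comparable to convolution by
    [g]. *)
Definition dominated k g : Prop :=
  [/\ forall y, 0 <= g y, summ g & forall x y, normc (k x y) <= g y].

(** The discriminant criterion for [P - 2 * t * Q + t ^+ 2 * S], from which Cauchy-Schwarz for sums
    is derived. *)
Lemma sqr_le_discr (P Q S : R) : 0 <= P -> 0 <= Q -> 0 <= S ->
  (forall t, 0 <= t -> 2 * t * Q <= P + t ^+ 2 * S) -> Q ^+ 2 <= P * S.
Proof.
move=> P0 Q0 S0 h; have [S1|S1] := eqVneq S 0.
  have [->|Q1] := eqVneq Q 0; first by rewrite expr0n/= mulr_ge0.
  have Qp : 0 < Q by rewrite lt_neqAle eq_sym Q1.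
  (* With [S = 0] and [Q > 0] the left side can be made [P + 1], a contradiction. Otherwise the
     minimizer [t = Q / S] is used. *)
  have := h ((P + 1) / (2 * Q)) ltac:(by rewrite divr_ge0//; lra).
  rewrite S1 mulr0 addr0; have -> : 2 * ((P + 1) / (2 * Q)) * Q = P + 1 by field; lra.
  by move=> h1; lra.
have Sp : 0 < S by rewrite lt_neqAle eq_sym S1.
have := h (Q / S) ltac:(by rewrite divr_ge0).
have -> : 2 * (Q / S) * Q = 2 * (Q ^+ 2 / S) by field; lra.
have -> : (Q / S) ^+ 2 * S = Q ^+ 2 / S by field; lra.
by move=> h'; rewrite -ler_pdivrMr//; lra.
Qed.

(* Cauchy-Schwarz for the measure with density [g], then Tonelli. *)
Lemma young g (u : L -> R[i]) : (forall y, 0 <= g y) -> summ g -> in_l2 u ->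
  [/\ forall x, summ (fun y => g y * normc (u (x - y))),
      summ (fun x => nsum (fun y => g y * normc (u (x - y))) ^+ 2)
    & nsum (fun x => nsum (fun y => g y * normc (u (x - y))) ^+ 2) <=
      nsum g ^+ 2 * nsum (fun x => normc (u x) ^+ 2)].
Proof.
move=> g0 gs us.
have nu0 z : 0 <= normc (u z) by exact: normc_ge0.
have nu20 z : 0 <= normc (u z) ^+ 2 by exact: sqr_ge0.
have S0 := nsum_ge0 g0; have B0 := nsum_ge0 nu20.
have p0 x y : 0 <= g y * normc (u (x - y)) ^+ 2 by rewrite mulr_ge0.
have shift y : nsum (fun x => normc (u (x - y)) ^+ 2) =
    nsum (fun x => normc (u x) ^+ 2).
  exact: (nsum_bij (fun x => normc (u x) ^+ 2) (subrK y) (addrK y)).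
have shifts y : summ (fun x => normc (u (x - y)) ^+ 2).
  exact: (summ_bij (p := fun x => normc (u x) ^+ 2) (subrK y) (addrK y)).
have inner y : nsum (fun x => g y * normc (u (x - y)) ^+ 2) =
    nsum (fun x => normc (u x) ^+ 2) * g y.
  by rewrite nsumZ// shift mulrC.
have ps : summ2 (fun x y => g y * normc (u (x - y)) ^+ 2).
  (* With [y] outermost each inner sum is a translate of the squared norm of [u], hence the same for
     all [y] up to the factor [g y]. *)
  apply: summ2_swap => //; apply/summ2P => //; split=> [y|].
    exact: summZ.
  by under eq_fun do rewrite inner; apply: summZ.
have [p1 p2] := (summ2P p0).1 ps.
have q0 x y : 0 <= g y * normc (u (x - y)) by rewrite mulr_ge0.
have qs x : summ (fun y => g y * normc (u (x - y))).
  apply: le_summ (summD g0 (p0 x) gs (p1 x)) => y.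
  rewrite -{2}[g y]mulr1 -mulrDr ler_wpM2l//.
  by have := sqr_ge0 (normc (u (x - y)) - 1); rewrite sqrrB; have := nu0 (x - y); lra.
have cs x : nsum (fun y => g y * normc (u (x - y))) ^+ 2 <=
    nsum g * nsum (fun y => g y * normc (u (x - y)) ^+ 2).
  (* The quadratic inequality is [2 * t * s <= s ^+ 2 + t ^+ 2], with [s] the modulus of
     [u (x - y)], integrated against [g]. *)
  rewrite [leRHS]mulrC; apply: sqr_le_discr => //; try exact: nsum_ge0.
  move=> t t0; rewrite -!nsumZ ?sqr_ge0 ?mulr_ge0//.
  have tg0 y : 0 <= t ^+ 2 * g y by rewrite mulr_ge0 ?sqr_ge0.
  have tgs : summ (fun y => t ^+ 2 * g y) by apply: summZ; rewrite ?sqr_ge0.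
  rewrite -nsumD//; apply: le_nsum => [y|y|].
  - by rewrite !mulr_ge0.
  - have -> : 2 * t * (g y * normc (u (x - y))) =
      g y * (2 * t * normc (u (x - y))) by ring.
    have -> : g y * normc (u (x - y)) ^+ 2 + t ^+ 2 * g y =
      g y * (normc (u (x - y)) ^+ 2 + t ^+ 2) by ring.
    rewrite ler_wpM2l//; have := sqr_ge0 (normc (u (x - y)) - t).
    by rewrite sqrrB; lra.
  - exact: summD.
have n0 x : 0 <= nsum (fun y => g y * normc (u (x - y)) ^+ 2) by exact: nsum_ge0.
have sq : summ (fun x => nsum g * nsum (fun y => g y * normc (u (x - y)) ^+ 2)).
  exact: summZ.
split=> //; first exact: le_summ cs sq.
apply: le_trans (le_nsum _ cs sq) _; first by move=> x; exact: sqr_ge0.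
rewrite nsumZ// nsum_exchange// (eq_nsum inner) nsumZ//.
by rewrite le_eqVlt; apply/orP; left; apply/eqP; ring.
Qed.

Definition kconv k (u : L -> R[i]) x : R[i] := csum (fun y => k x y * u (x - y)).

Definition kop k : H -> H := fun b => to_l2 (kconv k b).

Section Dominated.
Variables (k : L -> L -> R[i]) (g : L -> R) (kg : dominated k g).

Let g0 y : 0 <= g y. Proof. by case: kg. Qed.
Let gs : summ g. Proof. by case: kg. Qed.
Let kle x y : normc (k x y) <= g y. Proof. by case: kg. Qed.

Lemma summc_kconv (u : L -> R[i]) x : in_l2 u -> summc (fun y => k x y * u (x - y)).
Proof.
move=> us; have [h _ _] := young g0 gs us; apply: le_summ (h x) => y.
by rewrite Normc.normcM ler_wpM2r// normc_ge0.
Qed.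

Let kconv_le u x : in_l2 u ->
  normc (kconv k u x) ^+ 2 <= nsum (fun y => g y * normc (u (x - y))) ^+ 2.
Proof.
move=> us; have [h _ _] := young g0 gs us.
have q0 y : 0 <= g y * normc (u (x - y)) by rewrite mulr_ge0 ?normc_ge0.
rewrite lerXn2r ?nnegrE ?normc_ge0 ?nsum_ge0//.
apply: le_trans (normc_csum_le (summc_kconv x us)) _.
apply: le_nsum => // y; first exact: normc_ge0.
by rewrite Normc.normcM ler_wpM2r// normc_ge0.
Qed.

Lemma in_l2_kconv (u : L -> R[i]) : in_l2 u -> in_l2 (kconv k u).
Proof.
move=> us; have [_ h _] := young g0 gs us; apply: le_summ h => x.
exact: kconv_le.
Qed.

Lemma kopE b x : kop k b x = kconv k b x.
Proof. by rewrite /kop to_l2K//; exact: in_l2_kconv (in_l2P b). Qed.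

Lemma kop_norm_le b : hnorm ip (kop k b) <= nsum g * hnorm ip b.
Proof.
have [_ h1 h2] := young g0 gs (in_l2P b).
rewrite -(@ler_pXn2r _ 2)// ?nnegrE ?mulr_ge0 ?l2_hnorm_ge0 ?nsum_ge0//.
rewrite exprMn !l2_sqr_hnorm; apply: le_trans h2.
apply: le_nsum => // x; first exact: sqr_ge0.
by rewrite kopE; exact: kconv_le (in_l2P b).
Qed.

Lemma bounded_kop : bounded_op ip (kop k).
Proof.
split=> [s a b|]; last by exists (nsum g) => b; exact: kop_norm_le.
apply: l2_ext => x; rewrite l2DE l2ZE !kopE /kconv.
have sa := summc_kconv x (in_l2P a); have sb := summc_kconv x (in_l2P b).
rewrite -csumZ// -csumD//; last exact: summcZ.
by apply: eq_csum => y; rewrite l2DE l2ZE; ring.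
Qed.

End Dominated.

Definition kcomm (h : L -> R) k x y : R[i] := real_complex R (h x - h (x - y)) * k x y.

(** Under the sum [h x] is split as [(h x - h (x - y)) + h (x - y)]. For [b] in the domain both
    resulting terms are in l2, so the same identity shows that the domain is preserved and what the
    commutator is. *)
Lemma kop_commutator h k g g' : dominated k g -> dominated (kcomm h k) g' ->
  commutator ip (mulop h) (kop k) (kop (kcomm h k)).
Proof.
move=> kg kg'.
have split (b : H) (hb : in_l2 (hm h b)) x :
    hm h (kop k b) x = kop (kcomm h k) b x + kop k (to_l2 (hm h b)) x.
  rewrite (kopE kg') !(kopE kg) /Defs.mul_fun (kopE kg) /kconv.
  have s1 := summc_kconv kg x (in_l2P b).
  have s2 := summc_kconv kg' x (in_l2P b).
  have s3 := summc_kconv kg x (in_l2P (to_l2 (hm h b))).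
  rewrite -csumZ// -csumD//; apply: eq_csum => y.
  rewrite (to_l2K hb) /kcomm /Defs.mul_fun rmorphB/=.
  ring.
have dom (b : H) : in_l2 (hm h b) -> in_l2 (hm h (kop k b)).
  move=> hb; rewrite (_ : hm h (kop k b) =
    fun x => 1 * kop (kcomm h k) b x + kop k (to_l2 (hm h b)) x).
    by apply: in_l2_lin; exact: in_l2P.
  by apply/funext => x; rewrite mul1r split.
split; [exact: bounded_kop kg|exact: bounded_kop kg'|exact: dom|].
move=> b hb; apply: l2_ext => x; rewrite l2BE /= (to_l2K (dom _ hb)) split//.
by rewrite addrK.
Qed.

(** Each commutator spends one of the available powers of [h x - h (x - y)] while the dominating
    function [g] stays the same, so [ad_dom_kop] can iterate. *)
Lemma dominated_kcomm h k g n : (forall y, 0 <= g y) -> summ g ->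
  (forall j, (j <= n.+1)%N -> forall x y,
    `|h x - h (x - y)| ^+ j * normc (k x y) <= g y) ->
  dominated k g /\ dominated (kcomm h k) g /\ (forall j, (j <= n)%N -> forall x y,
    `|h x - h (x - y)| ^+ j * normc (kcomm h k x y) <= g y).
Proof.
move=> g0 gs hk; split; last split.
- by split=> // x y; have := hk 0%N isT x y; rewrite expr0 mul1r.
- split=> // x y; have := hk 1%N isT x y.
  by rewrite expr1 /kcomm Normc.normcM normc_real.
- move=> j jn x y; have := hk j.+1 jn x y.
  by rewrite /kcomm Normc.normcM normc_real mulrA -exprSr.
Qed.

Lemma ad_dom_kop h k g n : (forall y, 0 <= g y) -> summ g ->
  (forall j, (j <= n)%N -> forall x y,
    `|h x - h (x - y)| ^+ j * normc (k x y) <= g y) ->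
  ad_dom ip (mulop h) n (kop k).
Proof.
move=> g0 gs; elim: n k => [|n IH] k hk /=.
  apply: (@bounded_kop k g); split=> // x y.
  by have := hk 0%N isT x y; rewrite expr0 mul1r.
have [d1 [d2 d3]] := dominated_kcomm g0 gs hk.
by exists (kop (kcomm h k)); [exact: kop_commutator d1 d2|exact: IH].
Qed.

End Kernels.

(** * The twisted convolution algebras *)

Section Twisted.
Variables (R : realType) (L : zmodType) (c : L -> L -> R[i]).
Hypothesis cDl : forall x x' y, c (x + x') y = c x y * c x' y.
Hypothesis cDr : forall x y y', c x (y + y') = c x y * c x y'.
Hypothesis c_unit : forall x y, Normc.normc (c x y) = 1.
Local Notation H := (l2 R L).
Local Notation ip := (@l2_ip R L).
Local Notation normc := Normc.normc.
Implicit Types (x y z : L) (a b : L -> R[i]) (d : H).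

Let c_neq0 x y : c x y != 0.
Proof.
by apply/eqP => h; have := c_unit x y; rewrite h Normc.normc0; lra.
Qed.

Let c0r x : c x 0 = 1.
Proof. by apply: (mulfI (c_neq0 x 0)); rewrite -cDr addr0 mulr1. Qed.

Let c0l x : c 0 x = 1.
Proof. by apply: (mulfI (c_neq0 0 x)); rewrite -cDl addr0 mulr1. Qed.

Let cJ x y : c x y * (c x y)^* = 1.
Proof. by rewrite mul_conj_normc c_unit expr1n. Qed.

Let cNl x y : c (- x) y = (c x y)^*.
Proof.
by apply: (mulfI (c_neq0 x y)); rewrite -cDl subrr c0l cJ.
Qed.

Definition tker a x y : R[i] := a y * c y (x - y).

Lemma tconv_kconv a b : tconv c a b = kconv (tker a) b.
Proof.
by apply/funext => x; apply: eq_csum => y; rewrite /tker mulrAC.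
Qed.

Lemma lconv_kop a : lconv c a = kop (tker a).
Proof. by apply/funext => d; rewrite /lconv tconv_kconv. Qed.

Lemma dominated_tker a : in_l1 a -> dominated (tker a) (fun y => normc (a y)).
Proof.
move=> ha; split=> // [y|x y]; first exact: normc_ge0.
by rewrite Normc.normcM c_unit mulr1.
Qed.

Lemma lconvE a d x : in_l1 a -> lconv c a d x = tconv c a d x.
Proof. by move=> ha; rewrite lconv_kop (kopE (dominated_tker ha)) tconv_kconv. Qed.

Lemma bounded_lconv a : in_l1 a -> bounded_op ip (lconv c a).
Proof. by move=> /dominated_tker ha; rewrite lconv_kop; exact: bounded_kop ha. Qed.

Lemma summ2_conv (p q : L -> R) : (forall x, 0 <= p x) -> (forall x, 0 <= q x) ->
  summ p -> summ q -> summ2 (fun x y => p y * q (x - y)).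
Proof.
move=> p0 q0 ps qs; have pq0 x y : 0 <= p y * q (x - y) by rewrite mulr_ge0.
apply: summ2_swap => //; apply/summ2P => //.
have sh y : summ (fun x => q (x - y)).
  exact: (summ_bij (subrK y) (addrK y)).
split=> [y|]; first exact: summZ.
have -> : (fun y => nsum (fun x => p y * q (x - y))) = (fun y => nsum q * p y).
  apply/funext => y; rewrite nsumZ// mulrC; congr (_ * _).
  exact: (nsum_bij q (subrK y) (addrK y)).
by apply: summZ => //; exact: nsum_ge0.
Qed.

(** Submultiplicativity at [x = y + (x - y)] dominates the weighted twisted convolution by the plain
    convolution of the weighted families. *)
Lemma summ_tconv (w : L -> R) a b : (forall x, 0 <= w x) ->
  (forall x y, w (x + y) <= w x * w y) ->
  in_l1 a -> in_l1 b ->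
  summ (fun x => normc (a x) * w x) -> summ (fun x => normc (b x) * w x) ->
  summ (fun x => normc (tconv c a b x) * w x).
Proof.
move=> w0 wM a1 b1 aw bw.
have n0 (u : L -> R[i]) x : 0 <= normc (u x) by exact: normc_ge0.
have nw0 (u : L -> R[i]) x : 0 <= normc (u x) * w x by rewrite mulr_ge0.
have [s1 _] := (summ2P (fun x y => mulr_ge0 (n0 a y) (n0 b (x - y)))).1
  (summ2_conv (n0 a) (n0 b) a1 b1).
have [t1 t2] := (summ2P (fun x y => mulr_ge0 (nw0 a y) (nw0 b (x - y)))).1
  (summ2_conv (nw0 a) (nw0 b) aw bw).
have tle x y : normc (a y * b (x - y) * c y (x - y)) <= normc (a y) * normc (b (x - y)).
  by rewrite !Normc.normcM c_unit mulr1.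
apply: le_summ t2 => x.
have h : normc (tconv c a b x) <= nsum (fun y => normc (a y) * normc (b (x - y))).
  have sx : summc (fun y => a y * b (x - y) * c y (x - y)).
    exact: le_summ (tle x) (s1 x).
  apply: le_trans (normc_csum_le sx) _; apply: le_nsum => // y.
  exact: normc_ge0.
apply: (@le_trans _ _ (nsum (fun y => w x * (normc (a y) * normc (b (x - y)))))).
  rewrite nsumZ// => [|y]; last by rewrite mulr_ge0.
  by rewrite mulrC ler_wpM2l.
apply: le_nsum => // y; first by rewrite !mulr_ge0.
rewrite mulrACA mulrC ler_wpM2l ?mulr_ge0//.
by have := wM y (x - y); rewrite addrCA subrr addr0.
Qed.

Lemma in_l1E a : in_l1 a <-> summ (fun x => normc (a x) * 1).
Proof. by under eq_fun do rewrite mulr1. Qed.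

Lemma in_l1_tconv a b : in_l1 a -> in_l1 b -> in_l1 (tconv c a b).
Proof.
move=> ha hb; apply/in_l1E; apply: (@summ_tconv (fun=> 1)) => //.
- by move=> *; rewrite mulr1.
- exact: (in_l1E a).1.
- exact: (in_l1E b).1.
Qed.

(** The third factor is a vector of l2, as needed for composing operators. Its coordinates are
    bounded by its norm, so the double sum converges absolutely; the scalar factors agree by the
    cocycle identity, a consequence of bimultiplicativity. *)
Lemma tconvA a b d : in_l1 a -> in_l1 b ->
  tconv c (tconv c a b) d = tconv c a (tconv c b d).
Proof.
move=> ha hb; apply/funext => x.
have n0 (u : L -> R[i]) y : 0 <= normc (u y) by exact: normc_ge0.
pose F z y := a y * b (z - y) * d (x - z) * c y (z - y) * c z (x - z).
have D0 := l2_hnorm_ge0 d.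
have Fs : summ2 (fun z y => normc (F z y)).
  have sc : summ2 (fun z y => (hnorm ip d * normc (a y)) * normc (b (z - y))).
    apply: (summ2_conv _ (n0 b) _ hb) => [y|]; first by rewrite mulr_ge0.
    exact: summZ.
  apply: le_summ2 sc => z y; rewrite /F !Normc.normcM !c_unit !mulr1.
  rewrite mulrC mulrA ler_wpM2r// ler_wpM2r//; exact: l2_coord_le.
have ab z : summc (fun y => a y * b (z - y) * c y (z - y)).
  have [s1 _] := (summ2P (fun x y => mulr_ge0 (n0 a y) (n0 b (x - y)))).1
    (summ2_conv (n0 a) (n0 b) ha hb).
  by apply: le_summ (s1 z) => y; rewrite !Normc.normcM c_unit mulr1.
transitivity (csum (fun z => csum (F z))).
  apply: eq_csum => z; rewrite /F.
  by rewrite -mulrA mulrC -(csumZ _ (ab z)); apply: eq_csum => y; ring.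
rewrite csum_exchange//; apply: eq_csum => y.
have bd : summc (fun z => b z * d (x - y - z) * c z (x - y - z)).
  have := summc_kconv (dominated_tker hb) (x - y) (in_l2P d).
  by apply: le_summ => z; rewrite /tker !Normc.normcM; lra.
rewrite mulrAC -(csumZ _ bd).
(* The inner summation variable on the right is shifted by [y], which aligns the arguments of [b]
   and [d]. *)
rewrite -[RHS](csum_bij _ (subrK y) (addrK y)); apply: eq_csum => z.
have -> : x - y - (z - y) = x - z by rewrite opprB addrA subrK.
have -> : c y (x - y) = c y (z - y) * c y (x - z).
  by rewrite -cDr [z - y + _]addrC subrKA.
have -> : c (z - y) (x - z) = c z (x - z) * (c y (x - z))^*.
  by rewrite -cNl -cDl.
rewrite /F -[LHS]mulr1 -(cJ y (x - z)); ring.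
Qed.

Lemma in_l1_tstar a : in_l1 a -> in_l1 (tstar c a).
Proof.
move=> ha; have := summ_bij (p := fun x => normc (a x)) (@opprK L) (@opprK L) ha.
by apply: le_summ => x; rewrite Normc.normcM c_unit mul1r normc_conj.
Qed.

Lemma summ2_shear (p : L -> L -> R) : (forall x y, 0 <= p x y) -> summ2 p ->
  summ2 (fun x y => p (x + y) y).
Proof.
move=> p0 ps; apply: (@summ2_swap _ _ (fun y x => p (x + y) y)) => //.
have := summ2_swap p0 ps; rewrite /summ2.
congr (_ < _)%E; apply: eq_esum => y _.
exact: (esum_bij _ (addrK y) (subrK y)).
Qed.

Lemma lconv_adjoint a : in_l1 a ->
  adjoint_pair ip (lconv c a) (lconv c (tstar c a)).
Proof.
move=> ha b d; have hs := in_l1_tstar ha.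
have n0 (u : L -> R[i]) y : 0 <= normc (u y) by exact: normc_ge0.
pose G x y := a y * b (x - y) * c y (x - y) * (d x)^*.
have Gs : summ2 (fun x y => normc (G x y)).
  have [y1 y2 _] := young (n0 a) ha (in_l2P b).
  have q0 x y : 0 <= normc (d x) * (normc (a y) * normc (b (x - y))).
    by rewrite !mulr_ge0.
  have Q : summ2 (fun x y => normc (d x) * (normc (a y) * normc (b (x - y)))).
    apply/summ2P => //; split=> [x|].
      by apply: summZ => // y; rewrite mulr_ge0.
    have sq x : 0 <= nsum (fun y => normc (a y) * normc (b (x - y))) ^+ 2.
      exact: sqr_ge0.
    have dq x : 0 <= normc (d x) ^+ 2 by exact: sqr_ge0.
    (* Young's inequality puts the inner sum in l2, and its product with [d] is dominated by the sum
       of the two squares. *)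
    apply: le_summ (summD dq sq (in_l2P d) y2) => x.
    rewrite nsumZ// => [|y]; last by rewrite mulr_ge0.
    set s := nsum _; have := sqr_ge0 (normc (d x) - s).
    have := sqr_ge0 (normc (d x)); have := sqr_ge0 s.
    by rewrite sqrrB; lra.
  apply: le_summ2 Q => x y; rewrite /G !Normc.normcM c_unit normc_conj mulr1.
  by rewrite mulrC.
have sa x : summc (fun y => a y * b (x - y) * c y (x - y)).
  have := summc_kconv (dominated_tker ha) x (in_l2P b).
  by apply: le_summ => y; rewrite /tker !Normc.normcM; lra.
have ss x : summc (fun y => tstar c a y * d (x - y) * c y (x - y)).
  have := summc_kconv (dominated_tker hs) x (in_l2P d).
  by apply: le_summ => y; rewrite /tker !Normc.normcM; lra.
transitivity (csum (fun x => csum (G x))).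
  apply: eq_csum => x; rewrite lconvE// mulrC -csumZ//.
  by apply: eq_csum => y; rewrite /G mulrC.
rewrite csum_exchange//.
(* Adjointness amounts to the shear [x := x + y] in the double sum, followed by [y := - y] to match
   the involution. *)
transitivity (csum (fun x => csum (fun y => G (x + y) y))); last first.
  apply: eq_csum => x; rewrite lconvE// -csumJ -csumZ; last first.
    by have := ss x; apply: le_summ => y; rewrite normc_conj.
  rewrite -[RHS](csum_bij _ (@opprK L) (@opprK L)); apply: eq_csum => y.
  rewrite /G /tstar !opprK addrK !rmorphM/= conjCK !cNl conjCK.
  rewrite [c y (- y)](_ : _ = (c y y)^*); last first.
    by apply: (mulfI (c_neq0 y y)); rewrite -cDr subrr c0r cJ.
  (* The factor [c x x] of the involution contributes the conjugate of [c y y], which cancels the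
     [c y y] produced by the shift. *)
  rewrite cDr; have := cJ y y; set u := c y y; set u' := u^* => uu.
  rewrite ?conjCK -[LHS]mul1r -uu; ring.
have Gsh := summ2_shear (fun x y => normc_ge0 (G x y)) Gs.
rewrite [RHS]csum_exchange//; apply: eq_csum => y.
by rewrite -(csum_bij _ (addrK y) (subrK y)).
Qed.

(** * The weighted algebras and their density *)

Section Weighted.
Variable w : L -> R.
Hypotheses (w0 : forall x, 0 <= w x) (wM : forall x y, w (x + y) <= w x * w y)
  (wN : forall x, w (- x) = w x).

Let nw0 a x : 0 <= normc (a x) * w x.
Proof. by rewrite mulr_ge0// normc_ge0. Qed.

Lemma in_l1w_lin (s : R[i]) a b : in_l1w w a -> in_l1w w b -> in_l1w w (s *: a + b).
Proof.
move=> [a1 aw] [b1 bw]; have n0 (u : L -> R[i]) x : 0 <= normc (u x) by exact: normc_ge0.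
split.
  by apply: summcD => //; exact: summcZ.
have sa : summ (fun x => normc s * (normc (a x) * w x)).
  by apply: summZ => //; exact: normc_ge0.
apply: le_summ (summD _ (nw0 b) sa bw) => x; last by rewrite mulr_ge0// normc_ge0.
rewrite mulrA -mulrDl ler_wpM2r//; apply: le_trans (normcD _ _) _.
by rewrite -Normc.normcM.
Qed.

Lemma lconv_lin (s : R[i]) a b : in_l1 a -> in_l1 b ->
  lconv c (s *: a + b) = (fun d => s *: lconv c a d + lconv c b d).
Proof.
move=> ha hb; apply/funext => d; apply: l2_ext => x.
have hab : in_l1 (s *: a + b) by apply: summcD => //; exact: summcZ.
rewrite l2DE l2ZE !lconvE// !tconv_kconv /kconv.
have s1 := summc_kconv (dominated_tker ha) x (in_l2P d).
have s2 := summc_kconv (dominated_tker hb) x (in_l2P d).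
rewrite -csumZ// -csumD//; last exact: summcZ.
by apply: eq_csum => y; rewrite /tker -[(s *: a + b) y]/(s * a y + b y); ring.
Qed.

(** The point mass at 0 is a unit for twisted convolution because [c x 0 = 1], so applying the
    operator to it returns the sequence. *)
Lemma lconv_inj a b : in_l1 a -> in_l1 b -> lconv c a = lconv c b -> a = b.
Proof.
have lconv_delta u x : in_l1 u -> lconv c u (to_l2 (delta R (0 : L))) x = u x.
  move=> hu; rewrite lconvE// /tconv (csum_supp1 (x := x)) (to_l2K (in_l2_delta _ _)).
    by rewrite /delta subrr eqxx mulr1 c0r mulr1.
  by move=> y yx; rewrite /delta subr_eq0 eq_sym (negPf yx) mulr0 mul0r.
move=> ha hb ab; apply/funext => x.
by rewrite -(lconv_delta a x ha) ab lconv_delta.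
Qed.

Lemma twisted_embeddingP : twisted_embedding c w.
Proof.
split.
- move=> s a b ha hb; split; first exact: in_l1w_lin.
  by case: ha hb => ha _ [hb _]; exact: lconv_lin.
- move=> a b [a1 aw] [b1 bw]; split.
    by split; [exact: in_l1_tconv|exact: summ_tconv].
  apply/funext => d; apply: l2_ext => x /=.
  rewrite lconvE; last exact: in_l1_tconv.
  rewrite tconvA// lconvE//; congr (tconv c a _ x).
  by apply/funext => y; rewrite lconvE.
- move=> a [a1 aw]; split; last exact: lconv_adjoint.
  split; first exact: in_l1_tstar.
  have := summ_bij (p := fun x => normc (a x) * w x) (@opprK L) (@opprK L) aw.
  by apply: le_summ => x; rewrite Normc.normcM c_unit mul1r normc_conj wN.
- by move=> a [a1 _]; exact: bounded_lconv.
- by move=> a b [a1 _] [b1 _]; exact: lconv_inj.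
Qed.

Lemma star_subalgebra_l1w : star_subalgebra ip (twisted_l1w c w).
Proof.
have [lin mul star bnd _] := twisted_embeddingP.
have in0 : in_l1w w (0 : L -> R[i]).
  have z : normc 0 = 0 :> R by exact: Normc.normc0.
  split; apply: le_summ (summ0 R L) => x; rewrite -[(0 : L -> R[i]) x]/(0 : R[i]).
    by rewrite z.
  by rewrite z mul0r.
split.
- by move=> _ [a ha <-]; exact: bnd.
- exists 0 => //; apply/funext => d; apply: l2_ext => x; rewrite lconvE; last exact: in0.1.
  by rewrite /tconv (csum_supp1 (x := 0)) => [|y _]; rewrite !mul0r.
- move=> s _ _ [a ha <-] [b hb <-].
  by have [h1 h2] := lin s a b ha hb; exists (s *: a + b).
- by move=> _ _ [a ha <-] [b hb <-]; have [h1 h2] := mul a b ha hb; exists (tconv c a b).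
- move=> _ [a ha <-]; have [h1 h2] := star a ha.
  by exists (lconv c (tstar c a)) => //; exists (tstar c a).
Qed.

(** Finite truncations belong to every weighted space, and the operator norm of the remainder is at
    most its l1 norm, a tail of a convergent sum. *)
Lemma l1w_dense : lconv c @` @in_l1 R L `<=` op_closure ip (twisted_l1w c w).
Proof.
move=> _ [a ha <-]; split=> [|e e0]; first exact: bounded_lconv.
have n0 (u : L -> R[i]) y : 0 <= normc (u y) by exact: normc_ge0.
have [X hX] := nsum_tail (n0 a) ha e0.
have tX x : x \notin X -> trunc X a x = 0 by rewrite /trunc => /negPf ->.
have tw : in_l1w w (trunc X a).
  split; apply: (summ_fin_supp (X := X) _ _).1 => // x /tX ->.
    exact: Normc.normc0.
  by rewrite Normc.normc0 mul0r.
exists (lconv c (trunc X a)); first by exists (trunc X a).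
move=> d; pose r := (-1 : R[i]) *: trunc X a + a.
have hr : in_l1 r by apply: summcD => //; apply: summcZ; exact: tw.1.
have -> : lconv c a d - lconv c (trunc X a) d = lconv c r d.
  by rewrite lconv_lin//; [rewrite scaleN1r addrC|exact: tw.1].
rewrite lconv_kop; apply: le_trans (kop_norm_le (dominated_tker hr) d) _.
rewrite ler_wpM2r ?l2_hnorm_ge0//; apply: le_trans (ltW hX).
rewrite le_eqVlt; apply/orP; left; apply/eqP/eq_nsum => x.
rewrite /r -[(_ + a) x]/(-1 * trunc X a x + a x) /trunc mulN1r addrC.
by case: ifP; rewrite ?subrr ?subr0// => _; exact: Normc.normc0.
Qed.

End Weighted.

Lemma twisted_cstarE : twisted_cstar c = op_closure ip (twisted_l1w c (fun=> 1)).
Proof.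
congr (op_closure ip (_ @` _)); apply/seteqP; split=> a; last by case.
by move=> ha; split; [|exact: (in_l1E a).1].
Qed.

Lemma cstar_twisted : cstar_algebra ip (twisted_cstar c).
Proof.
rewrite twisted_cstarE; apply: cstar_op_closure; first exact: l2_hilbert.
by apply: star_subalgebra_l1w => // *; rewrite mulr1.
Qed.

Lemma dense_twisted (w : L -> R) : (forall x, 0 <= w x) ->
  (forall x y, w (x + y) <= w x * w y) -> (forall x, w (- x) = w x) ->
  dense_star_subalgebra ip (twisted_cstar c) (twisted_l1w c w).
Proof.
move=> w0 wM wN; split; first exact: star_subalgebra_l1w.
- move=> _ [a [a1 _] <-]; apply: (subset_op_closure (@l2_hilbert R L)).
    by move=> _ [b hb <-]; exact: bounded_lconv.
  by exists a.
- by apply: (op_closure_min (@l2_hilbert R L)); exact: l1w_dense.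
Qed.

End Twisted.

(** * Compactness of the resolvent *)

(** Compactness of the segment provides a cluster point, and a cluster point of an ultrafilter is a
    limit. *)
Lemma ultra_bounded_cvg (R : realType) (U : set_system nat) (w : nat -> R) (M : R) :
  UltraFilter U -> (forall n, `|w n| <= M) -> exists l : R, w @ U --> l.
Proof.
move=> UU wM; have UP := @ultra_proper _ _ UU.
have [|l [_ cl]] := @segment_compact R (- M) M (w @ U) _.
  by apply: (@filterE _ U) => n /=; rewrite in_itv/= -ler_norml.
exists l => B Bl; have [//|nB] := in_ultra_setVsetC (w @^-1` B) UU.
by have [x [nBx Bx]] := cl (~` B) B nB Bl.
Qed.

(* Convergence along a free ultrafilter is available for every bounded family at
   once, which avoids a diagonal extraction over the lattice. *)
Lemma free_ultrafilter : exists U : set_system nat,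
  UltraFilter U /\ forall N, U [set n | (N <= n)%N].
Proof.
have [U [UU hU]] := @ultraFilterLemma nat \oo _.
by exists U; split=> // N; apply: hU; exists N.
Qed.

(** Returns from the ultrafilter to an honest subsequence: increasing indices are picked in the sets
    of the filter on which [w] oscillates by less than [1 / k.+1]. *)
Lemma cauchy_subseq (R : realType) (V : lmodType R[i]) (ip : V -> V -> R[i])
    (U : set_system nat) (w : nat -> V) :
  is_hilbert ip -> ProperFilter U -> (forall N, U [set n | (N <= n)%N]) ->
  (forall e : R, 0 < e -> exists2 A, U A &
     forall m n, A m -> A n -> hnorm ip (w m - w n) < e) ->
  exists (phi : nat -> nat) (l : V),
    {homo phi : m n / (m < n)%N} /\ hcvg ip (fun n => w (phi n)) l.
Proof.
move=> hil UP Uoo h.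
have /choice[A hA] k : exists A, U A /\
    forall m n, A m -> A n -> hnorm ip (w m - w n) < (k.+1%:R^-1 : R).
  by have [A UA wA] := h k.+1%:R^-1 ltac:(by rewrite invr_gt0); exists A.
(* Finite intersections make the sets decreasing; the range includes [k] itself, so the tail from
   [N] on stays inside [A N]. *)
pose B k := \bigcap_(j in [set` [fset i in iota 0 k.+1]%fset]) A j.
have UB k : U (B k) by apply: filter_bigI => j _; exact: (hA j).1.
have BA k j : (j <= k)%N -> B k `<=` A j.
  move=> jk n /(_ j); apply.
  by rewrite /= !inE mem_iota add1n ltnS jk andbT lt0n orbN.
have /choice[nx hnx] (q : nat * nat) : exists n, B q.1 n /\ (q.2 < n)%N.
  have [n [Bn Nn]] := filter_ex (filterI (UB q.1) (Uoo q.2.+1)).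
  by exists n.
pose phi := fix phi k := if k is k'.+1 then nx (k, phi k') else nx (0%N, 0%N).
have phiB k : B k (phi k).
  by case: k => [|k]; [exact: (hnx (0, 0)%N).1|exact: (hnx (k.+1, phi k)).1].
have phiS : {homo phi : m n / (m < n)%N}.
  by apply: (homo_ltn ltn_trans) => i; exact: (hnx (i.+1, phi i)).2.
have [e e0|l hl] := let: And4 _ _ _ cpl := hil in cpl (fun n => w (phi n)).
  have [N hN] := ex_inv_nat e0; exists N => m n Nm Nn.
  apply: lt_trans hN; apply: (hA N).2.
    exact: BA Nm _ (phiB m).
  exact: BA Nn _ (phiB n).
by exists phi, l.
Qed.

Section CompactMultiplication.
Variables (R : realType) (L : zmodType).
Local Notation H := (l2 R L).
Local Notation ip := (@l2_ip R L).
Local Notation dip := (@dsum_ip R L).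
Local Notation normc := Normc.normc.
Local Notation hm := Defs.mul_fun.

(** Only coordinatewise convergence is obtained. The limit [l] serves as a reference point for
    comparing coordinates of two terms. *)
Lemma l2_ultra_cvg (U : set_system nat) (u : nat -> H) (M : R) : UltraFilter U ->
  (forall n, hnorm ip (u n) <= M) ->
  exists l : L -> R[i], forall x, (fun n => normc (u n x - l x) ^+ 2) @ U --> (0 : R).
Proof.
move=> UU uM; have UP := @ultra_proper _ _ UU.
have uc n x : normc (u n x) <= M := le_trans (l2_coord_le _ _) (uM n).
have /choice[lr hlr] x : exists l : R, (fun n => complex.Re (u n x)) @ U --> l.
  by apply: (ultra_bounded_cvg (M := M)) => n; exact: le_trans (Re_le_normc _) (uc n x).
have /choice[li hli] x : exists l : R, (fun n => complex.Im (u n x)) @ U --> l.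
  by apply: (ultra_bounded_cvg (M := M)) => n; exact: le_trans (Im_le_normc _) (uc n x).
exists (fun x => (lr x +i* li x)%C) => x.
have nE (z : R[i]) : normc z ^+ 2 = complex.Re z * complex.Re z + complex.Im z * complex.Im z.
  by case: z => r s /=; rewrite sqr_sqrtr ?addr_ge0 ?sqr_ge0.
under eq_fun do rewrite nE ReD ImD ReN ImN /=.
have -> : (0 : R) = 0 * 0 + 0 * 0 by rewrite mulr0 addr0.
have z1 : (fun n => complex.Re (u n x) - lr x) @ U --> (0 : R).
  by rewrite -(subrr (lr x)); apply: cvgB => //; exact: cvg_cst.
have z2 : (fun n => complex.Im (u n x) - li x) @ U --> (0 : R).
  by rewrite -(subrr (li x)); apply: cvgB => //; exact: cvg_cst.
by apply: cvgD; apply: cvgM.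
Qed.

Lemma hnorm_mul_split (g : L -> R) M d (X : {fset L}) (a : H) :
  (forall x, `|g x| <= M) -> (forall x, x \notin X -> `|g x| <= d) ->
  hnorm ip (to_l2 (hm g a)) ^+ 2 <=
  M ^+ 2 * (\sum_(x <- X) normc (a x) ^+ 2) + d ^+ 2 * hnorm ip a ^+ 2.
Proof.
move=> gM gd.
have n0 x : 0 <= normc (a x) ^+ 2 by exact: sqr_ge0.
have i0 x : 0 <= (if x \in X then normc (a x) ^+ 2 else 0) by case: ifP.
have [||isum iE] := @summ_fin_supp _ _ (fun x => if x \in X then normc (a x) ^+ 2 else 0) X => //.
  by move=> x /negPf ->.
have -> : \sum_(x <- X) normc (a x) ^+ 2 =
    nsum (fun x => if x \in X then normc (a x) ^+ 2 else 0).
  by rewrite iE; apply: eq_big_seq => x ->.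
have as2 : summ (fun x => normc (a x) ^+ 2) by exact: in_l2P.
rewrite !l2_sqr_hnorm -!nsumZ ?sqr_ge0//.
have t1 x : 0 <= M ^+ 2 * (if x \in X then normc (a x) ^+ 2 else 0).
  by rewrite mulr_ge0 ?sqr_ge0.
have t2 x : 0 <= d ^+ 2 * normc (a x) ^+ 2 by rewrite mulr_ge0 ?sqr_ge0.
rewrite -nsumD//; last 2 first.
- by apply: summZ; rewrite ?sqr_ge0.
- by apply: summZ; rewrite ?sqr_ge0.
apply: le_nsum => [x|x|]; first exact: sqr_ge0; last first.
  by apply: summD => //; apply: summZ; rewrite ?sqr_ge0.
have ge0M (r s : R) : `|r| <= s -> r ^+ 2 <= s ^+ 2.
  move=> rs; rewrite -real_normK ?num_real// lerXn2r ?nnegrE//.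
  exact: le_trans rs.
rewrite (to_l2K (in_l2_bounded_mul gM (in_l2P a))) normc_mul_fun exprMn.
rewrite real_normK ?num_real//; case: ifPn => xX.
  by rewrite -[leLHS]addr0 lerD// ler_wpM2r// ge0M.
by rewrite mulr0 add0r ler_wpM2r// ge0M// gd.
Qed.

Lemma compact_op_mul (g : L -> R) M : (forall x, `|g x| <= M) ->
  (forall e, 0 < e -> finite_set [set x | e <= `|g x|]) ->
  compact_op ip (fun b : H => to_l2 (hm g b)).
Proof.
move=> gM gfin; have bmul := bounded_op_mul gM; split=> // u [K0 uK0].
have [U [UU Uoo]] := free_ultrafilter; have UP := @ultra_proper _ _ UU.
pose K := `|K0| + 1; have K1 : 0 < K by rewrite /K; have := normr_ge0 K0; lra.
have uK n : hnorm ip (u n) <= K.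
  by rewrite /K; have := uK0 n; have := ler_norm K0; lra.
have [l hl] := l2_ultra_cvg UU uK.
apply: (cauchy_subseq (w := fun n => to_l2 (hm g (u n))) (@l2_hilbert R L) UP Uoo) => e e0.
have M0 : 0 <= M := le_trans (normr_ge0 (g 0)) (gM 0).
(* Off the finite set [X] the difference contributes at most [d ^+ 2 * (2 * K) ^+ 2 = e ^+ 2 / 4].
   On [X], [eta] is tuned to give [(M ^+ 2 + 1) * (4 * eta) = e ^+ 2 / 2]. Together this is below
   [e ^+ 2]. *)
pose d := e / (4 * K); have d0 : 0 < d by rewrite divr_gt0//; lra.
pose eta := e ^+ 2 / (8 * (M ^+ 2 + 1)).
have eta0 : 0 < eta.
  by rewrite divr_gt0 ?exprn_gt0// mulr_gt0//; have := sqr_ge0 M; lra.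
pose X := fset_set [set x | d <= `|g x|].
have gX x : x \notin X -> `|g x| <= d.
  rewrite in_fset_set; last exact: gfin.
  by rewrite notin_setE /= => /negP; rewrite -ltNge => /ltW.
have lim : (fun n => \sum_(x <- X) normc (u n x - l x) ^+ 2) @ U -->
    \sum_(x <- X) (0 : R).
  by apply: cvg_big => [|x _]; [exact: add_continuous|exact: hl].
rewrite big1// in lim; have /cvgrPdist_lt/(_ _ eta0) hA := lim.
exists [set n | `|0 - \sum_(x <- X) normc (u n x - l x) ^+ 2| < eta] => // m n.
have s0 k : 0 <= \sum_(x <- X) normc (u k x - l x) ^+ 2.
  by apply: sumr_ge0 => x _; exact: sqr_ge0.
rewrite /= !sub0r !normrN !ger0_norm// => Am An.
rewrite -(bopB bmul) -(@ltr_pXn2r _ 2)// ?nnegrE ?l2_hnorm_ge0 ?(ltW e0)//.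
apply: le_lt_trans (hnorm_mul_split (u m - u n) gM gX) _.
have sum4 : \sum_(x <- X) normc ((u m - u n) x) ^+ 2 <= 4 * eta.
  apply: (@le_trans _ _ (\sum_(x <- X) 2 * (normc (u m x - l x) ^+ 2 +
    normc (u n x - l x) ^+ 2))).
    apply: ler_sum => x _; have tr : normc ((u m - u n) x) <=
        normc (u m x - l x) + normc (u n x - l x).
      by rewrite l2BE -(subrKA (l x)) [normc (u n x - _)]normcB normcD.
    apply: (@le_trans _ _ ((normc (u m x - l x) + normc (u n x - l x)) ^+ 2)).
      by rewrite lerXn2r ?nnegrE ?addr_ge0 ?normc_ge0.
    have := sqr_ge0 (normc (u m x - l x) - normc (u n x - l x)).
    by rewrite sqrrB sqrrD; lra.
  by rewrite -mulr_sumr big_split/=; lra.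
have h1 : M ^+ 2 * (\sum_(x <- X) normc ((u m - u n) x) ^+ 2) <= e ^+ 2 / 2.
  apply: (@le_trans _ _ ((M ^+ 2 + 1) * (4 * eta))).
    apply: ler_pM => //; first exact: sqr_ge0.
      by apply: sumr_ge0 => x _; exact: sqr_ge0.
    lra.
  by rewrite /eta le_eqVlt; apply/orP; left; apply/eqP; field; have := sqr_ge0 M; lra.
have h2 : d ^+ 2 * hnorm ip (u m - u n) ^+ 2 <= e ^+ 2 / 4.
  apply: (@le_trans _ _ (d ^+ 2 * (2 * K) ^+ 2)).
    rewrite ler_wpM2l ?sqr_ge0// lerXn2r ?nnegrE ?l2_hnorm_ge0//; first lra.
    apply: le_trans (hnormB (@l2_hilbert R L) _ _) _.
    by have := uK m; have := uK n; lra.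
  by rewrite /d le_eqVlt; apply/orP; left; apply/eqP; field; lra.
have := exprn_gt0 2 e0; lra.
Qed.

Lemma compact_swap_diag s (T : H -> H) : compact_op ip T ->
  compact_op dip (swap_diag s T).
Proof.
move=> [Tb hT]; split=> [|u [M uM]]; first exact: bounded_swap_diag.
have [|phi [l1 [phiS h1]]] := hT (fun n => (u n).1).
  by exists M => n; exact: le_trans (dsum_hnorm1 _) (uM n).
(* The second component is extracted along the subsequence found for the first. *)
have [|psi [l2 [psiS h2]]] := hT (fun n => (u (phi n)).2).
  by exists M => n; exact: le_trans (dsum_hnorm2 _) (uM _).
exists (phi \o psi), (swap_if s (l1, l2)); split=> [m n mn|]; first exact/phiS/psiS.
have psi_ge n : (n <= psi n)%N.
  elim: n => [//|n IH]; apply: leq_ltn_trans IH _; exact: psiS.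
have h1' : hcvg ip (fun n => T (u (phi (psi n))).1) l1.
  apply/hcvgP => e e0; move/hcvgP: h1 => /(_ e e0)[N hN].
  by exists N => n Nn; apply: hN; exact: leq_trans Nn (psi_ge n).
have h := @dsum_hcvg _ _ (fun n => diag_action T (u (phi (psi n)))) _ _ h1' h2.
apply/hcvgP => e e0; move/hcvgP: h => /(_ e e0)[N hN]; exists N => n Nn.
have := hN n Nn; rewrite -(hnorm_swap s).
by rewrite /swap_diag; case: s.
Qed.

Lemma compact_op_comp (V : lmodType R[i]) (ipV : V -> V -> R[i]) (S T : V -> V) :
  is_hilbert ipV -> bounded_op ipV S -> compact_op ipV T -> compact_op ipV (S \o T).
Proof.
move=> hil Sb [Tb hT]; split=> [|u ub]; first exact: bounded_op_comp.
have [phi [l [phiS hl]]] := hT u ub; exists phi, (S l); split=> //.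
exact: (bounded_op_cont Sb hl).
Qed.

(** * The inverse square root of [1 + D ^ 2] *)

Section Resolvent.
Variable h : L -> R.

Definition resolvent_weight x : R := (Num.sqrt (1 + h x ^+ 2))^-1.
Local Notation g := resolvent_weight.

Let den_gt0 x : 0 < 1 + h x ^+ 2.
Proof. by have := sqr_ge0 (h x); lra. Qed.

Lemma resolvent_weight_gt0 x : 0 < g x.
Proof. by rewrite invr_gt0 sqrtr_gt0. Qed.

Lemma sqr_resolvent_weight x : g x * g x = (1 + h x ^+ 2)^-1.
Proof. by rewrite -invfM -expr2 sqr_sqrtr// ltW. Qed.

Lemma resolvent_weight_le x : `|g x| <= 1.
Proof.
rewrite ger0_norm; last exact/ltW/resolvent_weight_gt0.
rewrite /resolvent_weight invf_le1 ?sqrtr_gt0//.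
rewrite -{1}(sqrtr1 R) ler_wsqrtr//.
by have := sqr_ge0 (h x); lra.
Qed.

(** Converts properness of [h] into vanishing at infinity of the multiplier: its superlevel sets lie
    in sublevel sets of [h]. *)
Lemma resolvent_weight_fin (x : L) e : 0 < e -> e <= `|g x| -> h x <= e^-1.
Proof.
move=> e0; rewrite ger0_norm => [eg|]; last exact/ltW/resolvent_weight_gt0.
have : Num.sqrt (1 + h x ^+ 2) <= e^-1.
  by rewrite -[leLHS]invrK lef_pV2 ?posrE ?invr_gt0 ?sqrtr_gt0.
apply: le_trans; apply: le_trans (ler_norm _) _.
by rewrite -sqrtr_sqr ler_wsqrtr// lerDr.
Qed.

Let G := fun b : H => to_l2 (hm g b).

Lemma inv_sqrt_offdiag : is_inv_sqrt dip (offdiag h) (swap_diag false G).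
Proof.
have gl2 (u : L -> R[i]) := in_l2_bounded_mul (u := u) resolvent_weight_le.
have gg x : 0 <= (1 + h x ^+ 2)^-1 <= 1.
  rewrite invr_ge0 ltW//= invf_le1//; have := sqr_ge0 (h x); lra.
(* The multipliers [h / (1 + h ^ 2)] and [h ^ 2 / (1 + h ^ 2)] are bounded by 1, which places the
   range of [G \o G] in the domains of [D] and of its square. *)
have h1 x : `|h x * (1 + h x ^+ 2)^-1| <= 1.
  rewrite normrM [X in _ * X]ger0_norm; last by case/andP: (gg x).
  rewrite ler_pdivrMr// mul1r.
  have : h x ^+ 2 = `|h x| ^+ 2 by rewrite real_normK ?num_real.
  by have := sqr_ge0 (`|h x| - 1); rewrite sqrrB; have := normr_ge0 (h x); lra.
have h2 x : `|h x ^+ 2 * (1 + h x ^+ 2)^-1| <= 1.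
  rewrite ger0_norm; last by rewrite mulr_ge0 ?sqr_ge0//; case/andP: (gg x).
  by rewrite ler_pdivrMr// mul1r; have := sqr_ge0 (h x); lra.
have GG (b : H) x : G (G b) x = real_complex R (1 + h x ^+ 2)^-1 * b x.
  rewrite /G (to_l2K (gl2 _ (in_l2P _))) /Defs.mul_fun (to_l2K (gl2 _ (in_l2P _))).
  by rewrite /Defs.mul_fun mulrA -rmorphM sqr_resolvent_weight.
have d1 (b : H) : in_l2 (hm h (G (G b))).
  have -> : hm h (G (G b)) = hm (fun x => h x * (1 + h x ^+ 2)^-1) b.
    by apply/funext => x; rewrite /Defs.mul_fun GG rmorphM mulrA.
  exact: in_l2_bounded_mul h1 (in_l2P b).
have d2 (b : H) : in_l2 (hm h (to_l2 (hm h (G (G b))))).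
  have -> : hm h (to_l2 (hm h (G (G b)))) =
      hm (fun x => h x ^+ 2 * (1 + h x ^+ 2)^-1) b.
    apply/funext => x; rewrite {1}/Defs.mul_fun (to_l2K (d1 b)) /Defs.mul_fun GG.
    by rewrite expr2 !rmorphM !mulrA.
  exact: in_l2_bounded_mul h2 (in_l2P b).
have eqn (b : H) : G (G b) + to_l2 (hm h (to_l2 (hm h (G (G b))))) = b.
  apply: l2_ext => x; rewrite l2DE (to_l2K (d2 b)) {1}/Defs.mul_fun (to_l2K (d1 b)).
  rewrite /Defs.mul_fun GG !mulrA -mulrDl -!rmorphM -rmorphD.
  have -> : (1 + h x ^+ 2)^-1 + h x * h x * (1 + h x ^+ 2)^-1 = 1.
    by field; have := den_gt0 x; lra.
  by rewrite rmorph1 mul1r.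
split.
- by apply: bounded_swap_diag; exact: bounded_op_mul resolvent_weight_le.
- move=> p; rewrite /dsum_ip/= addr_ge0// l2_ip_mul_ge0// => [x||x|].
  + exact/ltW/resolvent_weight_gt0.
  + exact: gl2 (in_l2P _).
  + exact/ltW/resolvent_weight_gt0.
  + exact: gl2 (in_l2P _).
- move=> [p1 p2]; split; first by split; split; [exact: d1|exact: d1|exact: d2|exact: d2].
  by congr pair; exact: eqn.
Qed.

Lemma compact_inv_sqrt : (forall M, finite_set [set x | h x <= M]) ->
  compact_op dip (swap_diag false G).
Proof.
move=> hfin; apply: compact_swap_diag.
apply: (compact_op_mul resolvent_weight_le) => e e0.
apply: sub_finite_set (hfin e^-1) => x /=; exact: resolvent_weight_fin.
Qed.

End Resolvent.
End CompactMultiplication.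

(** * The spectral triple *)

Section SpectralTripleOfLattice.
Variables (R : realType) (L : zmodType) (c : L -> L -> R[i]).
Hypothesis cDl : forall x x' y, c (x + x') y = c x y * c x' y.
Hypothesis cDr : forall x y y', c x (y + y') = c x y * c x y'.
Hypothesis c_unit : forall x y, Normc.normc (c x y) = 1.
Variables (v h : L -> R) (K : R).
Hypothesis v_ge1 : forall x, 1 <= v x.
Hypothesis vM : forall x y, v (x + y) <= v x * v y.
Hypothesis vN : forall x, v (- x) = v x.
Hypothesis h_ge0 : forall x, 0 <= h x.
Hypothesis h_lip : forall x y, `|h (x + y) - h x| <= K * v y.
Local Notation ip := (@l2_ip R L).
Local Notation dip := (@dsum_ip R L).
Local Notation normc := Normc.normc.
Local Notation pi := (@diag_action R L).
Local Notation calA n := (twisted_l1w c (fun x => v x ^+ n)).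

Let w0 n x : 0 <= v x ^+ n.
Proof. by rewrite exprn_ge0// (le_trans _ (v_ge1 x)). Qed.

Let wM n x y : v (x + y) ^+ n <= v x ^+ n * v y ^+ n.
Proof.
have v0 z : 0 <= v z by rewrite (le_trans _ (v_ge1 z)).
by rewrite -exprMn lerXn2r ?nnegrE ?mulr_ge0.
Qed.

Let wN n x : v (- x) ^+ n = v x ^+ n.
Proof. by rewrite vN. Qed.

Lemma twisted_embedding_weight n : twisted_embedding c (fun x => v x ^+ n).
Proof. exact: twisted_embeddingP. Qed.

(* The iterated commutators of [lconv c a] with multiplication by [h] have
   kernels [(h x - h (x - y)) ^+ j * tker c a x y], dominated by
   [K ^+ j * v y ^+ j * |a y|]. *)
Lemma tker_diff_le n a j x y : (j <= n)%N ->
  `|h x - h (x - y)| ^+ j * normc (tker c a x y) <=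
  Num.max 1 K ^+ n * (normc (a y) * v y ^+ n).
Proof.
move=> jn; rewrite Normc.normcM c_unit mulr1 [leLHS]mulrC [leRHS]mulrCA.
rewrite ler_wpM2l ?normc_ge0// -exprMn.
(* With [Num.max 1 K] in place of [K] the base [Num.max 1 K * v y] is at least 1, so its [n]-th
   power bounds all lower ones. *)
have m1 : 1 <= Num.max 1 K by rewrite le_max lexx.
have mv1 : 1 <= Num.max 1 K * v y.
  by rewrite (le_trans m1)// ler_peMr// (le_trans ler01).
have d1 : `|h x - h (x - y)| <= Num.max 1 K * v y.
  have := h_lip (x - y) y; rewrite subrK => /le_trans; apply.
  by rewrite ler_wpM2r ?(le_trans _ (v_ge1 y))// le_max lexx orbT.
apply: (@le_trans _ _ ((Num.max 1 K * v y) ^+ j)).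
  by rewrite lerXn2r ?nnegrE// (le_trans _ mv1).
exact: ler_weXn2l.
Qed.

(** [T'] is fixed before [k], so the commutator with [D] and its iterated commutators concern the
    same operator for every order. It has already spent one power of [v], and [k] further
    commutators need [k + 1] in all. *)
Lemma lconv_commutators n a : (1 <= n)%N -> in_l1w (fun x => v x ^+ n) a ->
  exists2 T', commutator ip (mulop h) (lconv c a) T' &
    forall k, (k + 1 <= n)%N ->
      ad_dom ip (mulop h) k (lconv c a) /\ ad_dom ip (mulop h) k T'.
Proof.
move=> n1 [a1 an].
pose g y := Num.max 1 K ^+ n * (normc (a y) * v y ^+ n).
have m0 : 0 <= Num.max 1 K by rewrite le_max ler01.
have aw0 y : 0 <= normc (a y) * v y ^+ n := mulr_ge0 (normc_ge0 _) (w0 n y).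
have g0 y : 0 <= g y := mulr_ge0 (exprn_ge0 n m0) (aw0 y).
have gs : summ g by exact: (summZ aw0 (exprn_ge0 n m0) an).
have hk j : (j <= n)%N -> forall x y,
    `|h x - h (x - y)| ^+ j * normc (tker c a x y) <= g y.
  by move=> jn x y; exact: tker_diff_le.
have hk' k : (k + 1 <= n)%N -> forall j, (j <= k.+1)%N -> forall x y,
    `|h x - h (x - y)| ^+ j * normc (tker c a x y) <= g y.
  by rewrite addn1 => kn j jk; apply: hk; exact: leq_trans jk kn.
exists (kop (kcomm h (tker c a))).
  have [d1 [d2 _]] := dominated_kcomm g0 gs (hk' 0%N n1).
  by rewrite lconv_kop; exact: kop_commutator d1 d2.
move=> k kn; have [_ [_ d3]] := dominated_kcomm g0 gs (hk' k kn).
rewrite lconv_kop; split; last exact: ad_dom_kop g0 gs d3.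
apply: (ad_dom_kop g0 gs) => j jk; apply: (hk' k kn); exact: leqW.
Qed.

Lemma twisted_spectral_datum n : (1 <= n)%N ->
  spectral_datum ip dip (twisted_cstar c) pi (calA n) (offdiag h).
Proof.
move=> n1; have cA := cstar_twisted cDl cDr c_unit.
have bnd T : twisted_cstar c T -> bounded_op ip T by case.
split.
- by split; [exact: l2_hilbert|].
- exact: dense_twisted.
- split; first exact: dsum_hilbert.
  split.
  + by move=> T /bnd Tb; exact: (bounded_swap_diag false Tb).
  + by move=> s S T _ _ p.
  + by move=> S T _ _ p.
  + by move=> S T _ _ ST p q; rewrite /dsum_ip/= !ST.
- exact: (swap_mul_selfadjoint true h).
- move=> _ [a ha <-]; have [T' cT' _] := lconv_commutators n1 ha.
  exists (swap_diag true T'); exact: (diag_comm false true cT').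
Qed.

Lemma twisted_grading n : has_grading dip pi (calA n) (offdiag h).
Proof.
apply: offdiag_grading => _ [a [a1 _] <-]; exact: bounded_lconv.
Qed.

Lemma twisted_compact_resolvent n : (forall M, finite_set [set x | h x <= M]) ->
  compact_resolvent dip pi (calA n) (offdiag h).
Proof.
move=> hfin; eexists; first exact: inv_sqrt_offdiag.
move=> _ [a [a1 _] <-].
apply: compact_op_comp; [exact: dsum_hilbert| |exact: compact_inv_sqrt].
by apply: (bounded_swap_diag false); exact: bounded_lconv.
Qed.

Lemma twisted_quantum_Ck n k : (k + 1 <= n)%N ->
  calA n `<=` quantum_differentiable dip pi (calA n) (offdiag h) k /\
  quantum_Ck dip pi (calA n) (offdiag h) k.
Proof.
move=> kn; have n1 : (1 <= n)%N by apply: leq_trans kn; rewrite addn1.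
have hP := swap_mul_abs h_ge0.
have key T : calA n T -> ad_dom dip (swap_mul false h) k (pi T) /\
    exists2 T', commutator dip (offdiag h) (pi T) T' &
      ad_dom dip (swap_mul false h) k T'.
  move=> [a ha <-]; have [T' cT' /(_ k kn)[ad1 ad2]] := lconv_commutators n1 ha.
  split; first exact: (ad_dom_swap_diag false ad1).
  exists (swap_diag true T'); first exact: (diag_comm false true cT').
  exact: (ad_dom_swap_diag true ad2).
split=> [T AT|].
  have [k1 k2] := key T AT.
  by split=> //; exists (swap_mul false h).
by exists (swap_mul false h).
Qed.

End SpectralTripleOfLattice.

(** * The Heisenberg cocycle as a unimodular bicharacter *)

Section Heisenberg.
Variables (R : realType) (G : topologicalZmodType).
Variable L : zmodClosed (G * dual R G)%type.
Implicit Types x y z : subgroup L.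
Local Notation c := (@heisenberg R G L).

Lemma heisenbergDl x x' y : c (x + x') y = c x y * c x' y.
Proof.
by rewrite /heisenberg; have [_ h _] := dualP (subgroup_val y).2; rewrite h rmorphM.
Qed.

(** Addition in the dual is pointwise multiplication of characters, so only multiplicativity of
    conjugation remains. *)
Lemma heisenbergDr x y y' : c x (y + y') = c x y * c x y'.
Proof. exact: rmorphM. Qed.

Lemma normc_heisenberg x y : Normc.normc (c x y) = 1.
Proof.
rewrite normc_conj; have [_ _ h] := dualP (subgroup_val y).2.
by have := h (subgroup_val x).1 => /(congr1 (@complex.Re R)).
Qed.

End Heisenberg.

(** Submultiplicativity at 0 gives [1 <= v 0], and at [x] and [- x], with symmetry,
    [v 0 <= v x ^+ 2]. *)
Lemma weight_ge1 (R : realType) (G : topologicalZmodType) (v : G * dual R G -> R) x :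
  is_weight v -> 1 <= v x.
Proof.
move=> [[v0 v00] vM _ vN].
have v0_gt0 : 0 < v 0 by rewrite lt_neqAle eq_sym v00 v0.
have v0_ge1 : 1 <= v 0.
  by have := vM 0 0; rewrite addr0 -[leLHS]mulr1 ler_pM2l.
have : 1 <= v x * v x.
  by apply: le_trans v0_ge1 _; have := vM x (- x); rewrite subrr vN.
by have := v0 x; nra.
Qed.

(** The embedding clause justifies treating the operators in [calA n] as elements of the weighted
    sequence algebra. Properness conditions only the compactness of the resolvent; the remaining
    axioms, the grading and the regularity are asserted outright. *)
Theorem proposition5p11 (R : realType) (G : topologicalZmodType)
    (v : G * dual R G -> R) (Lam : zmodClosed (G * dual R G)%type) (f : R -> R)
    (G_hausdorff : hausdorff_space G)
    (G_locally_compact : locally_compact [set: G])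
    (G_second_countable : @second_countable G)
    (v_weight : is_weight v)
    (Lam_lattice : is_lattice Lam)
    (f_compatible : spectral_triple_compatible Lam v f) :
  let c := @heisenberg R G Lam in
  let vL : subgroup Lam -> R := fun x => v (subgroup_val x) in
  let A := twisted_cstar c in
  let calA (n : nat) := twisted_l1w c (fun x => vL x ^+ n) in
  let H_ip := @dsum_ip R (subgroup Lam) in
  let pi := @diag_action R (subgroup Lam) in
  let D := offdiag (fun x => f (vL x)) in
  (forall n : nat, twisted_embedding c (fun x => vL x ^+ n)) /\
  (forall n : nat, (1 <= n)%N ->
     [/\ spectral_datum (@l2_ip R (subgroup Lam)) H_ip A pi (calA n) D,
         has_grading H_ip pi (calA n) D
       & proper_on Lam (fun x => f (v x)) ->
         even_spectral_triple (@l2_ip R (subgroup Lam)) H_ip A pi (calA n) D]) /\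
  (forall n k : nat, (k + 1 <= n)%N ->
     calA n `<=` quantum_differentiable H_ip pi (calA n) D k /\
     quantum_Ck H_ip pi (calA n) D k).
Proof.
move=> c vL A calA H_ip pi D.
have [f0 [Cdif [Csm [Cgr [Cdif0 Csm0 Cgr0 fP]]]]] := f_compatible.
have LP (x : subgroup Lam) : subgroup_val x \in Lam := valP x.
have v_ge1 x : 1 <= vL x := weight_ge1 _ v_weight.
have [[v0 _] vM _ vN] := v_weight.
have vLM x y : vL (x + y) <= vL x * vL y := vM _ _.
have vLN x : vL (- x) = vL x := vN _.
have h0 x : 0 <= f (vL x) := f0 _ (v0 _).
have hlip x y : `|f (vL (x + y)) - f (vL x)| <= Cdif * Cgr * vL y.
  have [h1 _ _] := fP _ _ (LP x) (LP y); have [_ _ h3] := fP _ _ (LP y) (LP y).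
  by apply: le_trans h1 _; rewrite -mulrA ler_wpM2l.
have cDl := @heisenbergDl R G Lam; have cDr := @heisenbergDr R G Lam.
have c1 := @normc_heisenberg R G Lam.
split; last split.
- by move=> n; exact: twisted_embedding_weight.
- move=> n n1; have datum := twisted_spectral_datum cDl cDr c1 v_ge1 vLM vLN hlip n1.
  have grad := twisted_grading c1 vL (fun x => f (vL x)) n.
  split=> // hproper; split=> //; split=> //.
  apply: twisted_compact_resolvent => // M.
  (* Properness is a statement about points of the ambient group; injectivity of [subgroup_val]
     carries finiteness over to the lattice as a type. *)
  have inj : set_inj (@subgroup_val _ Lam @^-1`
      [set x | x \in Lam /\ f (v x) <= M]) (@subgroup_val _ Lam).
    by move=> x y _ _; exact: val_inj.
  by apply: sub_finite_set (finite_preimage inj (hproper M)) => x /= xM.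
- move=> n k kn; exact: (twisted_quantum_Ck c1 v_ge1 h0 hlip kn).
Qed.
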